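(* Let $r\geqslant3$, let $\mathcal A_1$ be the class of $r$th order linear ODEs in the first Arnold form $x^{(r)}+a_{r-1}(t)x^{(r-1)}+\dots+a_1(t)x^{(1)}=b(t)$ with arbitrary smooth functions $a_{r-1},\dots,a_1,b$ of $t$, and let $\widehat{\mathcal A}_1$ be its subclass of homogeneous equations ($b=0$). The classes $\mathcal A_1$ and $\widehat{\mathcal A}_1$ are not semi-normalized.
   Context: The underlying field $\mathbb F$ is $\mathbb R$ or $\mathbb C$; all variables, functions and constants are real or complex, respectively. $x=x(t)$ is the unknown function, $x^{(k)}=d^kx/dt^k$. Everything is local: functions and transformations are smooth and considered on suitable open domains. A point transformation is a transformation $\tilde t=T(t,x)$, $\tilde x=X(t,x)$ with nonvanishing Jacobian $\partial(T,X)/\partial(t,x)$; it acts on ODEs via prolongation to derivatives. The arbitrary elements of a class of ODEs are the functions (coefficients, right-hand side) parameterizing it. An admissible transformation of a class is a triple $(\mathcal E,\tilde{\mathcal E},\mathcal T)$, where $\mathcal E$ and $\tilde{\mathcal E}$ are equations of the class and $\mathcal T$ is a point transformation mapping $\mathcal E$ to $\tilde{\mathcal E}$. The (usual) equivalence (pseudo)group of the class consists of the point transformations in the joint space of $t$, $x$, the derivatives of $x$ and the arbitrary elements that are consistent with the contact structure (the components for derivatives are obtained by prolongation), are projectable to the $(t,x)$-space (the components for $t$ and $x$ depend only on $(t,x)$), and map every equation of the class to an equation of the class. A class is semi-normalized if for every admissible transformation $(\mathcal E,\tilde{\mathcal E},\mathcal T)$, $\mathcal T$ is the composition of a point symmetry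 transformation of $\mathcal E$ followed by the projection of an equivalence transformation to the $(t,x)$-space. *)

(* Defs.v *)
From mathcomp Require Import all_boot all_order all_algebra complex.
From mathcomp Require Import all_classical all_reals all_analysis.

Set Implicit Arguments.
Unset Strict Implicit.
Unset Printing Implicit Defensive.
Import Order.TTheory GRing.Theory Num.Theory.
Import numFieldNormedType.Exports.
Local Open Scope classical_set_scope.
Local Open Scope ring_scope.

(* The base field K is meant to be R : realType or R[i]; all derivatives are
   taken over K, so that for K = R[i] "smooth" means holomorphic. *)

Section Smooth.
Context {K : numFieldType} {V W : normedModType K}.

Fixpoint Cn_on (n : nat) (A : set V) (f : V -> W) : Prop :=
  if n is n'.+1 then
    (forall p, A p -> differentiable f p) /\
    (forall v : V, Cn_on n' A (fun p => 'D_v f p))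
  else forall p, A p -> {for p, continuous f}.

Definition smooth_on (A : set V) (f : V -> W) := forall n, Cn_on n A f.

End Smooth.

Section Jets.
Context {K : numFieldType} {r : nat}.

(* A point (t, x, x^(1), ..., x^(r)) of the jet space of order r; its first two
   coordinates (t, x) are obtained by lsubmx. *)
Definition jet := 'rV[K]_(2 + r).

Definition jt_idx : 'I_(2 + r) := ord0.
Definition jx_idx (k : nat) : 'I_(2 + r) := inord k.+1.

Definition jt (q : jet) : K := q ord0 jt_idx.

(* The coordinate x^(k), for k <= r. *)
Definition jx (q : jet) (k : nat) : K := q ord0 (jx_idx k).

Definition base (q : jet) : 'rV[K]_2 := lsubmx q.

(* Total derivative D_t = d_t + sum_k x^(k+1) d_(x^(k)). It is truncated at
   k < r, hence correct for the functions of order less than r, which are the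
   only ones it is applied to below (when r >= 1). *)
Definition total_derivative (F : jet -> K) (q : jet) : K :=
  'D_(delta_mx ord0 jt_idx : jet) F q
  + \sum_(k < r) jx q k.+1 * 'D_(delta_mx ord0 (jx_idx k) : jet) F q.

(* A point transformation tau has the components T = tau _ 0 0 and
   X = tau _ 0 1. *)
Definition DtT (tau : 'rV[K]_2 -> 'rV[K]_2) : jet -> K :=
  total_derivative (fun q => tau (base q) ord0 ord0).

Fixpoint prolong_coord (tau : 'rV[K]_2 -> 'rV[K]_2) (k : nat) : jet -> K :=
  if k is k'.+1 then
    fun q => total_derivative (prolong_coord tau k') q / DtT tau q
  else fun q => tau (base q) ord0 ord_max.

(* Meaningful only at the jets q with DtT tau q != 0. *)
Definition prolong (tau : 'rV[K]_2 -> 'rV[K]_2) (q : jet) : jet :=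
  row_mx (tau (base q)) (\row_(k < r) prolong_coord tau k.+1 q).

End Jets.
Arguments jet : clear implicits.

Definition point_transformation (K : numFieldType)
    (tau : 'rV[K]_2 -> 'rV[K]_2) (Om : set 'rV[K]_2) : Prop :=
  [/\ open Om, Om !=set0, smooth_on Om tau &
      forall p, Om p -> \det ('J tau p) != 0].

(* A class of ODEs  eqn (t, x, ..., x^(r)) (theta t) = 0  of order r, whose
   tuple theta of arbitrary elements ranges over all smooth functions of t with
   npar components. *)
Record ode_class (K : numFieldType) := OdeClass {
  order : nat;
  npar : nat;
  eqn : jet K order -> 'rV[K]_npar -> K }.

Record ode (K : numFieldType) (C : ode_class K) := Ode {
  dom : set K;
  par : K -> 'rV[K]_(npar C);
  dom_open : open dom;
  dom_neq0 : dom !=set0;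
  par_smooth : smooth_on dom par }.

Section Transformations.
Context {K : numFieldType} {C : ode_class K}.

Definition manifold (E : ode C) : set (jet K (order C)) :=
  [set q | dom E (jt q) /\ eqn q (par E (jt q)) = 0].

(* tau maps the part of E lying over Om to E'. As tau is a local
   diffeomorphism, this is expressed on jets by an equivalence. *)
Definition maps_to (tau : 'rV[K]_2 -> 'rV[K]_2) (Om : set 'rV[K]_2)
    (E E' : ode C) : Prop :=
  forall q : jet K (order C), Om (base q) -> dom E (jt q) -> DtT tau q != 0 ->
    dom E' (jt (prolong tau q)) /\
    (manifold E q <-> manifold E' (prolong tau q)).

Definition admissible (E E' : ode C) (tau : 'rV[K]_2 -> 'rV[K]_2)
    (Om : set 'rV[K]_2) : Prop :=
  [/\ point_transformation tau Om,
      forall p, Om p -> dom E (p ord0 ord0) &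
      maps_to tau Om E E'].

Definition point_symmetry (E : ode C) (tau : 'rV[K]_2 -> 'rV[K]_2)
    (Om : set 'rV[K]_2) : Prop :=
  admissible E E tau Om.

(* A point (t, x, x^(1), ..., x^(r), theta) of the joint space of variables,
   derivatives and arbitrary elements. *)
Definition joint := 'rV[K]_(2 + order C + npar C).

(* Phi, defined on the open set Wd of the joint space, is an equivalence
   transformation of the class C, and sigma, defined on the projection Om of Wd,
   is its projection to the (t, x)-space. That the (t, x)-components depend only
   on (t, x) and that the other jet components are given by prolongation is the
   equality lsubmx (Phi z) = prolong sigma (lsubmx z). Every equation E of the
   class, whatever the values of its arbitrary elements, has to be mapped by
   sigma to an equation E' of the class, the graph of par E being sent by Phi
   to that of par E'. *)
Definition equivalence_transformation (Phi : joint -> joint) (Wd : set joint)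
    (sigma : 'rV[K]_2 -> 'rV[K]_2) (Om : set 'rV[K]_2) : Prop :=
  [/\ [/\ open Wd, smooth_on Wd Phi & forall z, Wd z -> \det ('J Phi z) != 0],
      point_transformation sigma Om /\ Om = [set base (lsubmx z) | z in Wd],
      forall z, Wd z ->
        DtT sigma (lsubmx z) != 0 /\
        lsubmx (Phi z) = prolong sigma (lsubmx z) &
      forall E : ode C, exists E' : ode C,
        maps_to sigma Om E E' /\
        (forall z, Wd z -> dom E (jt (lsubmx z)) ->
           rsubmx z = par E (jt (lsubmx z)) ->
           rsubmx (Phi z) = par E' (jt (lsubmx (Phi z))))].

End Transformations.

(* Everything being local, the factorization of an admissible transformation is
   only required after restriction to some nonempty open subset of its domain.
   This is the most permissive reading of the notion: its negation entails the
   negation of the variants asking for a factorization near every point, or on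
   the whole domain. *)
Definition semi_normalized (K : numFieldType) (C : ode_class K) : Prop :=
  forall (E E' : ode C) (tau : 'rV[K]_2 -> 'rV[K]_2) (Om : set 'rV[K]_2),
    admissible E E' tau Om ->
    exists (U : set 'rV[K]_2) (S : 'rV[K]_2 -> 'rV[K]_2)
           (Phi : @joint K C -> @joint K C) (Wd : set (@joint K C))
           (sigma : 'rV[K]_2 -> 'rV[K]_2) (OmPhi : set 'rV[K]_2),
      [/\ U `<=` Om,
          point_symmetry E S U,
          equivalence_transformation Phi Wd sigma OmPhi &
          forall p, U p -> OmPhi (S p) /\ tau p = sigma (S p)].

(* x^(r) + a_(r-1) x^(r-1) + ... + a_1 x^(1); the entry k of a is a_(k+1). *)
Definition arnold1_lhs (K : numFieldType) (r : nat) (q : jet K r)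
    (a : 'rV[K]_(r.-1)) : K :=
  jx q r + \sum_(k < r.-1) a ord0 k * jx q k.+1.

(* The arbitrary elements are (a_1, ..., a_(r-1), b). *)
Definition A1 (K : numFieldType) (r : nat) : ode_class K :=
  @OdeClass K r (r.-1 + 1) (fun q theta =>
    arnold1_lhs q (lsubmx theta) - (rsubmx theta) ord0 ord0).

(* The arbitrary elements are (a_1, ..., a_(r-1)). *)
Definition A1_hom (K : numFieldType) (r : nat) : ode_class K :=
  @OdeClass K r r.-1 (fun q a => arnold1_lhs q a).

(* Main.v *)
Require Import Defs.
From mathcomp Require Import all_boot all_order all_algebra complex.
From mathcomp Require Import all_classical all_reals all_analysis.
From mathcomp Require Import ring lra zify.
Set Implicit Arguments.
Unset Strict Implicit.
Unset Printing Implicit Defensive.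
Import Order.TTheory GRing.Theory Num.Theory.
Import numFieldNormedType.Exports.
Local Open Scope classical_set_scope.
Local Open Scope ring_scope.

(* The counterexample is the transformation t~ = t, x~ = x / t, which maps
   x^(r) = 0 to x^(r) + (r / t) x^(r-1) = 0.  Suppose that it equals sigma o S
   with S a point symmetry of x^(r) = 0 and sigma the projection of an
   equivalence transformation.

   Let D = D_t T for sigma = (T, X), and let J be its Jacobian.  Apply sigma to
   two equations with constant parameters that differ only in the parameter a_j,
   and subtract the image equations on jets with the same x, ..., x^(r-1): this
   gives x^(j) J / D^(r+1) = sum_(0 < k < r) g_k(T) x~^(k) + h(T).  As x~^(k) is,
   for k >= 2, affine in x^(k) with nonzero slope, all g_k with k > j vanish.
   Then j = 1 gives T_x = 0 and X_t = phi(T) T_t, j = 2 gives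
   (X_x / T_t)_x = 0, and hence locally T = T(t) and X = c x + X_0(t) with a
   constant c.

   Therefore S = (s(t), x / (c t) + g(t)), so that x~^(r) is affine in the jet
   coordinates.  As S is a symmetry, its coefficients A_(r,j) at x^(j) vanish for
   0 < j < r.  With w = 1 / s', A_(r,r-1) = 0 yields w' = 2 w / ((r-1) t), and then
   A_(r,r-2) is a positive multiple of w^r / (c t^3), which is absurd as r >= 3. *)

(** * Derivatives and smooth functions *)

Section Derivatives.
Context {K : numFieldType}.
Implicit Types V W : normedModType K.

(** The first-order expansion at [a] only involves the germ of the function, so the differential of
    [f] serves for [g] as well. *)
Lemma near_eq_differentiable V W (f g : V -> W) (a : V) :
  {near a, f =1 g} -> differentiable f a -> differentiable g a.
Proof.
move=> fg /diff_locallyP[df_cont /eqaddoP dfE].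
have dgE : g \o shift a = cst (g a) + 'd f a +o_ 0 id.
  apply/eqaddoP => e e0; have := dfE e e0.
  have : \forall h \near (0 : V), f (h + a) = g (h + a).
    by rewrite (near_shift a) /=; near=> z; rewrite /= sub0r subrK; near: z.
  apply: filter_app2; near=> h => fgh.
  have -> // : (f \o shift a - (cst (f a) + 'd f a)) h =
    (g \o shift a - (cst (g a) + 'd f a)) h.
  by rewrite !fctE /= fgh (nbhs_singleton fg).
by apply/diff_locallyP; rewrite (diff_unique df_cont dgE); split.
Unshelve. all: by end_near. Qed.

(** Equal difference quotients have equal limits. This carries derivatives between the jet space,
    the (t, x)-plane and the line without a chain rule. *)
Lemma derive_shift_eq V1 V2 W (f : V1 -> W) (g : V2 -> W) a v b u :
  (forall h : K, f (h *: v + a) - f a = g (h *: u + b) - g b) ->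
  'D_v f a = 'D_u g b.
Proof. by move=> fg; rewrite /derive; under eq_fun do rewrite /= fg. Qed.

Lemma derivable_shift_eq V1 V2 W (f : V1 -> W) (g : V2 -> W) a v b u :
  (forall h : K, f (h *: v + a) - f a = g (h *: u + b) - g b) ->
  derivable g b u -> derivable f a v.
Proof.
by move=> fg; rewrite /derivable;
  under [X in _ -> cvg (X @ _)]eq_fun do rewrite /= fg.
Qed.

Lemma derive_eq0 V W (f : V -> W) a v :
  (forall h : K, f (h *: v + a) = f a) -> 'D_v f a = 0.
Proof.
move=> fE; rewrite (@derive_shift_eq _ V _ f (cst 0) a v a v) ?derive_cst //.
by move=> h; rewrite fE !subrr.
Qed.

Lemma derive_affine V W (f : V -> W) a v w :
  (forall h : K, f (h *: v + a) = f a + h *: w) -> 'D_v f a = w.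
Proof.
move=> fE; rewrite /derive; apply: lim_near_cst => //; near=> h.
rewrite /= fE addrC addKr scalerA mulVf ?scale1r //.
by near: h; exact: nbhs_dnbhs_neq.
Unshelve. all: by end_near. Qed.

Lemma differentiable_coordE V n (f : V -> 'rV[K]_n) (p : V) j :
  differentiable f p -> differentiable (fun p => f p ord0 j) p.
Proof.
move=> df.
apply: (@differentiable_comp _ _ _ _ f (fun N : 'rV[K]_n => N ord0 j)) => //.
exact: differentiable_coord.
Qed.

Lemma derive_coord V n (f : V -> 'rV[K]_n) (p v : V) j :
  differentiable f p -> 'D_v (fun p => f p ord0 j) p = ('D_v f p) ord0 j.
Proof.
move=> df; rewrite !deriveE//; last exact: differentiable_coordE.
have @g : {linear 'rV[K]_n -> K}.
  by exists (fun N : 'rV[K]_n => N ord0 j); do 2![eexists]; do ?[constructor];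
     rewrite ?mxE// => ? *; rewrite ?mxE//; move=> ?; rewrite !mxE.
have cg : continuous g by exact: coord_continuous.
rewrite (_ : (fun p => _) = g \o f)// diff_comp//; last first.
  exact: linear_differentiable.
by rewrite /comp (diff_lin _ cg).
Qed.

End Derivatives.

Section Smoothness.
Context {K : numFieldType} {V : normedModType K} (A : set V).
Hypothesis openA : open A.
Implicit Types W : normedModType K.

Lemma open_near_eq W (f g : V -> W) p :
  (forall p, A p -> f p = g p) -> A p -> {near p, f =1 g}.
Proof.
move=> fg Ap; have := open_nbhs_nbhs (conj openA Ap).
by apply: filterS => z /fg.
Qed.

(** As [A] is open, agreement on [A] is agreement near each of its points and passes to all
    derivatives. A derivative can thus be replaced by a formula valid on [A] only. *)
Lemma Cn_on_ext n W (f g : V -> W) :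
  (forall p, A p -> f p = g p) -> Cn_on n A f -> Cn_on n A g.
Proof.
elim: n f g => [|n IH] f g fg /=.
  move=> fc p Ap; have nfg := open_near_eq fg Ap.
  have := fc _ Ap; rewrite /prop_for /continuous_at (fg _ Ap).
  by apply: cvg_trans; apply: near_eq_cvg.
move=> [df Df]; split=> [p Ap|v].
  exact: near_eq_differentiable (open_near_eq fg Ap) (df _ Ap).
apply: (IH ('D_v f)) (Df v) => p Ap.
exact: near_eq_derive (open_near_eq fg Ap).
Qed.

Lemma Cn_onW n W (f : V -> W) : Cn_on n.+1 A f -> Cn_on n A f.
Proof.
elim: n f => [|n IH] f /= [df Df].
  by move=> p Ap; apply: differentiable_continuous; exact: df.
by split=> // v; apply: IH; exact: Df.
Qed.

Lemma Cn_on_cst n W (a : W) : Cn_on n A (fun _ => a).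
Proof.
elim: n W a => [|n IH] W a /=; first by move=> p _; exact: cvg_cst.
split=> [p _|v]; first exact: differentiable_cst.
apply: (Cn_on_ext (f := fun=> 0)) => // p _.
by rewrite (derive_cst a).
Qed.

Lemma Cn_onD n W (f g : V -> W) :
  Cn_on n A f -> Cn_on n A g -> Cn_on n A (fun p => f p + g p).
Proof.
elim: n f g => [|n IH] f g /=.
  by move=> fc gc p Ap; apply: cvgD; [exact: fc|exact: gc].
move=> [df Df] [dg Dg]; split=> [p Ap|v].
  by apply: differentiableD; [exact: df|exact: dg].
apply: Cn_on_ext (IH _ _ (Df v) (Dg v)) => p Ap.
by rewrite -deriveD //; apply: diff_derivable; [exact: df|exact: dg].
Qed.

Lemma Cn_onZl n W (f : V -> K) (w : W) :
  Cn_on n A f -> Cn_on n A (fun p => f p *: w).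
Proof.
elim: n f => [|n IH] f /=.
  by move=> fc p Ap; apply: cvgZr_tmp; exact: fc.
move=> [df Df]; split=> [p Ap|v].
  by apply: differentiableZl; exact: df.
apply: Cn_on_ext (IH _ (Df v)) => p Ap.
rewrite !deriveE ?diffZl //; try exact: df.
by apply: differentiableZl; exact: df.
Qed.

Lemma Cn_onM n (f g : V -> K) :
  Cn_on n A f -> Cn_on n A g -> Cn_on n A (fun p => f p * g p).
Proof.
elim: n f g => [|n IH] f g.
  by move=> fc gc p Ap; apply: cvgM; [exact: fc|exact: gc].
(* The Leibniz rule contains [f] and [g] themselves, which are needed at the lower order [n]. *)
move=> Cf Cg; have [fn gn] := (Cn_onW Cf, Cn_onW Cg).
move: Cf Cg => [df Df] [dg Dg]; split=> [p Ap|v].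
  by apply: differentiableM; [exact: df|exact: dg].
apply: Cn_on_ext (Cn_onD (IH _ _ fn (Dg v)) (IH _ _ gn (Df v))) => p Ap.
by rewrite -deriveM //; apply: diff_derivable; [exact: df|exact: dg].
Qed.

Lemma Cn_onV n (f : V -> K) : (forall p, A p -> f p != 0) ->
  Cn_on n A f -> Cn_on n A (fun p => (f p)^-1).
Proof.
move=> f0; elim: n => [|n IH].
  by move=> fc p Ap; apply: cvgV; [exact: f0|exact: fc].
move=> Cf; have Cfi := IH (Cn_onW Cf).
move: Cf => [df Df]; split=> [p Ap|v].
  by apply: differentiableV; [exact: df|exact: f0].
have Cf2 := Cn_onM (Cn_onZl (- 1 : K) Cfi) (Cn_onM Cfi (Df v)).
apply: Cn_on_ext Cf2 => p Ap.
rewrite (deriveV (f0 _ Ap)); last by apply: diff_derivable; exact: df.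
by rewrite scalerN /= [_ *: 1]mulr1 expr2 invfM mulNr mulrA scaleNr.
Qed.

Lemma Cn_on_coord n m (f : V -> 'rV[K]_m) j :
  Cn_on n A f -> Cn_on n A (fun p => f p ord0 j).
Proof.
elim: n f => [|n IH] f /=.
  move=> fc p Ap.
  apply: (@continuous_comp _ _ _ f (fun N : 'rV[K]_m => N ord0 j)).
    exact: fc.
  exact: coord_continuous.
move=> [df Df]; split=> [p Ap|v]; first exact/differentiable_coordE/df.
apply: Cn_on_ext (IH _ (Df v)) => p Ap.
by rewrite derive_coord//; exact: df.
Qed.

Lemma smooth_on_derive W (f : V -> W) v : smooth_on A f -> smooth_on A ('D_v f).
Proof. by move=> sf n; have [_] := sf n.+1; apply. Qed.

Lemma smooth_on_differentiable W (f : V -> W) p :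
  smooth_on A f -> A p -> differentiable f p.
Proof. by move=> sf; have [+ _] := sf 1; apply. Qed.

End Smoothness.

Lemma Cn_on_line (K : numFieldType) (V W : normedModType K) (A : set V)
    (e b : V) n (f : V -> W) :
  Cn_on n A f -> Cn_on n [set t : K | A (t *: e + b)] (fun t : K => f (t *: e + b)).
Proof.
have dl (t : K) : differentiable (fun t : K => t *: e + b) t.
  by apply: differentiableD => //; exact: differentiableZl.
elim: n f => [|n IH] f /=.
  move=> fc t At.
  apply: (@continuous_comp _ _ _ (fun t : K => t *: e + b) f); last exact: fc.
  exact: differentiable_continuous.
move=> [df Df]; split=> [t At|v].
  by apply: (differentiable_comp (dl t)); exact: df.
have -> : 'D_v (fun t : K => f (t *: e + b)) = fun t : K => 'D_(v *: e) f (t *: e + b).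
  apply/funext => t; apply: derive_shift_eq => h.
  by rewrite scalerA scalerDl addrA.
exact: (IH _ (Df _)).
Qed.

(** * Functions with zero derivative on a ball *)

(** The only property of the base field, beyond being a [numFieldType], on which the argument rests.
    It fails over the rationals, whose disks are disconnected, and is proved below separately for
    the real and the complex numbers. *)
Definition locally_constant_on_balls (K : numFieldType) : Prop :=
  forall (f : K -> K) (c e : K), 0 < e ->
    (forall z, `|z - c| < e -> is_derive z 1 f 0) ->
    forall z, `|z - c| < e -> f z = f c.

(** An estimate on a full disk of increments [k], to be restricted later to increments along a
    segment; the non-strict bound covers [k = 0]. *)
Lemma is_derive0_small (K : numFieldType) (f : K -> K) (w : K) :
  is_derive w 1 f 0 -> forall eps, 0 < eps ->
  exists2 d, 0 < d & forall k, `|k| < d -> `|f (k + w) - f w| <= eps * `|k|.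
Proof.
move=> [dfw dfw0] eps eps0.
have : (fun k : K => k^-1 *: ((f \o shift w) (k *: 1) - f w)) @ 0^' -->
  'D_1 f w := dfw.
rewrite dfw0 => /cvgrPdist_lt => /(_ _ eps0).
rewrite near_withinE => /nbhs_ballP[d /= d0 dH]; exists d => // k kd.
have [->|k0] := eqVneq k 0; first by rewrite add0r subrr !normr0 mulr0.
have := dH k; rewrite -ball_normE /= sub0r normrN => /(_ kd k0).
rewrite sub0r normrN [_ *: 1]mulr1 normrM normfV => /ltW.
by rewrite ler_pdivrMl ?normr_gt0// mulrC.
Qed.

Section RealComplex.
Variable R : realType.

Lemma real_locally_constant : locally_constant_on_balls R.
Proof.
move=> f c e e0 df.
have H (a b : R) : `|a - c| < e -> `|b - c| < e -> a < b -> f a = f b.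
  move=> ac bc ab.
  have dab x : a <= x -> x <= b -> is_derive x 1 f 0.
    move=> ax xb; apply: df.
    move: ac bc; rewrite !ltr_norml => /andP[? ?] /andP[? ?].
    by apply/andP; split; lra.
  have [||d _] := @MVT _ f (fun=> 0) a b ab.
  - by move=> x; rewrite in_itv /= => /andP[/ltW ax /ltW xb]; exact: dab.
  - apply: derivable_within_continuous => x; rewrite in_itv /= => /andP[ax xb].
    by have [] := dab _ ax xb.
  - by rewrite mul0r => /eqP; rewrite subr_eq0 => /eqP.
move=> z zc; have cc : `|c - c| < e by rewrite subrr normr0.
by case: (ltgtP z c) => [zc'|zc'|-> //]; [exact: H|apply/esym; exact: H].
Qed.

Import Num.Def ComplexField.

Lemma complex_locally_constant : locally_constant_on_balls (R[i] : numFieldType).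
Proof.
move=> f c e e0 df z zc.
have eR : e = (complex.Re e)%:C%C by rewrite RRe_real// gtr0_real.
(* the real and imaginary parts of f are constant on the segment from c to z *)
have key (h : R[i] -> R) : (forall x y, h (x - y) = h x - h y) ->
    (forall x, `|h x|%:C%C <= `|x|) ->
    (forall (u : R) x, h (u%:C%C * x) = u * h x) -> h (f z) = h (f c).
  move=> hB hle hZ.
  have [->//|zc_neq] := eqVneq z c.
  pose v := complex.Re `|z - c|.
  pose g u := h (f (u%:C%C * (z - c) + c)).
  have dg (u : R) : 0 <= u <= 1 -> is_derive u 1 g 0.
    move=> /andP[u0 u1].
    have Hz : `|u%:C%C * (z - c) + c - c| < e.
      rewrite addrK normrM; apply: le_lt_trans zc.
      rewrite ler_piMl // normc_def /= expr0n /= addr0 sqrtr_sqr ger0_norm //.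
      by rewrite lecR.
    have [dfz dfz0] := df _ Hz.
    set w := u%:C%C * (z - c) + c in Hz dfz dfz0.
    have vC : v%:C%C = `|z - c| by rewrite RRe_real// normr_real.
    have v0 : 0 < v by rewrite -ltcR vC normr_gt0 subr_eq0.
    suff gl : (fun k : R => k^-1 *: ((g \o shift u) (k *: 1) - g u)) @ 0^' --> (0 : R).
      by split; [exact: (cvgP _ gl)|exact: cvg_lim].
    apply/cvgrPdist_le => eps eps0.
    (* A parameter step [k] moves the argument by a vector of modulus [|k| * v]; dividing [eps] by
       [v] absorbs this factor. *)
    have epsv : 0 < (eps / v)%:C%C :> R[i] by rewrite ltcR divr_gt0.
    have [d d0 dH] := is_derive0_small (df _ Hz) epsv.
    have dR : d = (complex.Re d)%:C%C by rewrite RRe_real// gtr0_real.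
    have d0' : 0 < complex.Re d by rewrite -ltcR -dR.
    near=> k.
    have k0 : k != 0 by near: k; exact: nbhs_dnbhs_neq.
    have kd : `|k| < complex.Re d / v by near: k; apply: dnbhs0_lt; exact: divr_gt0.
    have kv : `|k%:C%C * (z - c)| = (`|k| * v)%:C%C.
      by rewrite normrM -vC normc_def /= expr0n /= addr0 sqrtr_sqr -rmorphM.
    have := dH (k%:C%C * (z - c)); rewrite kv dR ltcR -ltr_pdivlMr// => /(_ kd).
    rewrite -rmorphM /= mulrA mulrAC divfK ?gt_eqF// => fk.
    have gk : g (k + u) - g u = h (f (k%:C%C * (z - c) + w) - f w).
      by rewrite hB /g /w rmorphD /= mulrDl addrA.
    rewrite sub0r normrN /= [_ *: 1]mulr1 normrM normfV ler_pdivrMl ?normr_gt0//.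
    by rewrite gk -lecR (mulrC `|k|); apply: le_trans (hle _) fk.
  have [||d _] := @MVT _ g (fun=> 0) 0 1 ltr01.
  - by move=> x; rewrite in_itv /= => /andP[/ltW ax /ltW xb]; apply: dg; rewrite ax xb.
  - apply: derivable_within_continuous => x; rewrite in_itv /= => ax.
    by have [] := dg _ ax.
  - rewrite mul0r => /eqP; rewrite subr_eq0 => /eqP.
    by rewrite /g mul1r mul0r subrK add0r.
suff [fRe fIm] : complex.Re (f z) = complex.Re (f c) /\ complex.Im (f z) = complex.Im (f c).
  by case: (f z) fRe fIm; case: (f c) => a b a' b' /= -> ->.
split; apply: key.
- by case=> a b [].
- case=> a b; rewrite normc_def /= lecR -sqrtr_sqr ler_sqrt; nra.
- by move=> u [a b] /=; rewrite mul0r subr0.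
- by case=> a b [].
- case=> a b; rewrite normc_def /= lecR -sqrtr_sqr ler_sqrt; nra.
- by move=> u [a b] /=; rewrite mul0r addr0.
Unshelve. all: by end_near. Qed.
End RealComplex.

(** * Total derivatives and prolongations *)

(** With a, b, c, d standing for X_t, X_x, T_t, T_x and [z] for x^(1), the quotient is x~^(1), and
    the numerator of its derivative is the Jacobian. *)
Lemma is_derive_moebius (K : numFieldType) (a b c d z : K) :
  c + z * d != 0 ->
  is_derive z 1 (fun z : K => (a + z * b) / (c + z * d))
    ((b * c - a * d) / (c + z * d) ^+ 2).
Proof.
move=> z0.
have da (u v : K) : is_derive z 1 (fun z : K => u + z * v) v.
  apply: is_derive_eq.
  by rewrite scaler0 !add0r [_ *: _]mulr1.
have [dn Dn] := da a b; have [dd Dd] := da c d.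
have dV : derivable (fun z : K => (c + z * d)^-1) z 1.
  exact: (@derivableV _ _ (fun z : K => c + z * d)).
split; first exact: derivableM dn dV.
rewrite [LHS](deriveM dn dV) (@deriveV _ _ (fun z : K => c + z * d) _ _ z0 dd) Dn Dd /GRing.scale /=.
by field.
Qed.

Lemma det_mx22 (R : comNzRingType) (M : 'M[R]_2) :
  \det M = M ord0 ord0 * M ord_max ord_max - M ord0 ord_max * M ord_max ord0.
Proof.
rewrite (expand_det_row _ ord0) big_ord_recl big_ord1 /cofactor !det_mx11 !mxE /=.
rewrite expr0 expr1 mul1r mulN1r mulrN.
by congr (M _ _ * M _ _ - M _ _ * M _ _); apply: val_inj.
Qed.

Section JetCalculus.
Context {K : numFieldType} {r : nat}.
Implicit Types (q : jet K r) (tau : 'rV[K]_2 -> 'rV[K]_2).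

Local Notation e0 := (delta_mx ord0 ord0 : 'rV[K]_2).
Local Notation e1 := (delta_mx ord0 ord_max : 'rV[K]_2).
Local Notation E k := (delta_mx ord0 (jx_idx k) : jet K r).
Local Notation Et := (delta_mx ord0 jt_idx : jet K r).

Lemma jx_shift j k (h : K) q : (j <= r)%N -> (k <= r)%N ->
  jx (h *: E j + q) k = jx q k + h *+ (j == k).
Proof.
move=> jr kr; rewrite /jx !mxE eqxx /= addrC; congr (_ + _).
by rewrite -val_eqE /= !inordK ?ltnS // eqSS eq_sym; case: eqP; rewrite ?mulr1 ?mulr0.
Qed.

Lemma base_shift0 (h : K) q : base (h *: E 0 + q) = h *: e1 + base q.
Proof.
apply/rowP => i; rewrite !mxE /=; congr (_ * _%:R + _).
by rewrite -!val_eqE /= inordK //; case: i => [[|[|]]].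
Qed.

Lemma base_shiftS j (h : K) q : (0 < j <= r)%N -> base (h *: E j + q) = base q.
Proof.
move=> /andP[j0 jr]; apply/rowP => i; rewrite !mxE /=.
rewrite -val_eqE /= inordK ?ltnS //.
suff -> : (i == j.+1 :> nat) = false by rewrite mulr0 add0r.
by apply/negbTE; move: (ltn_ord i); case: j j0 {jr} => //; lia.
Qed.

Lemma base_shiftt (h : K) q : base (h *: Et + q) = h *: e0 + base q.
Proof. by apply/rowP => i; rewrite !mxE /=; congr (_ * _%:R + _). Qed.

Lemma jx_shiftt k (h : K) q : (k <= r)%N -> jx (h *: Et + q) k = jx q k.
Proof.
move=> kr; rewrite /jx !mxE /= -val_eqE /= inordK ?ltnS //.
by rewrite mulr0 add0r.
Qed.

Lemma jtE q : jt q = base q ord0 ord0.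
Proof. by rewrite /jt /base mxE; congr (q _ _); apply: val_inj. Qed.

Lemma jx0E q : jx q 0 = base q ord0 ord_max.
Proof. by rewrite /jx /base mxE; congr (q _ _); apply: val_inj; rewrite /= inordK. Qed.

(** The hypothesis says that [F] has order at most [k]. In D_t F the coordinate x^(k+1) then occurs
    only as the explicit factor of the summand of index [k]: the lower summands carry lower
    coordinates, and the higher ones vanish. *)
Lemma total_derivative_shift (F : jet K r -> K) k j (h : K) q :
  (forall i h q, (k < i <= r)%N -> F (h *: E i + q) = F q) ->
  (k < j <= r)%N ->
  total_derivative F (h *: E j + q) =
  total_derivative F q + (h * 'D_(E k) F q) *+ (j == k.+1).
Proof.
move=> Findep kjr; have /andP[kj jr] := kjr.
have kr : (k < r)%N := leq_trans kj jr.
have DF v : 'D_v F (h *: E j + q) = 'D_v F q.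
  by apply: derive_shift_eq => u; rewrite addrCA !Findep.
rewrite /total_derivative DF -addrA; congr (_ + _).
rewrite (bigD1 (Ordinal kr)) //= [in RHS](bigD1 (Ordinal kr)) //= DF.
rewrite jx_shift // mulrDl mulrnAl -!addrA; congr (_ + _).
rewrite addrC; congr (_ + _); apply: eq_bigr => i ik.
rewrite DF jx_shift ?(ltnW (ltn_ord i)) //.
case: (ltngtP i k) => [lik|lki|eik]; last by case/eqP: ik; exact: val_inj.
  by rewrite (gtn_eqF (leq_trans _ kj)) ?addr0 // ltnS.
rewrite [X in _ * X = _]derive_eq0 ?[X in _ = _ * X]derive_eq0 ?mulr0 // => u;
  by rewrite Findep // lki ltnW.
Qed.

Lemma total_derivative_order1 (f : 'rV[K]_2 -> K -> K) q : (1 < r)%N ->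
  total_derivative (fun q => f (base q) (jx q 1)) q =
  'D_e0 (f^~ (jx q 1)) (base q) + jx q 1 * 'D_e1 (f^~ (jx q 1)) (base q) +
  jx q 2 * 'D_1 (f (base q)) (jx q 1).
Proof.
move=> r1; have r0 := ltnW r1.
rewrite /total_derivative (bigD1 (Ordinal r0)) //= (bigD1 (Ordinal r1)) //=.
rewrite big1 ?addr0 => [|i /andP[i0 i1]]; last first.
  rewrite [X in _ * X]derive_eq0 ?mulr0 // => h.
  have {i0 i1} i1 : (1 < i)%N by move: i0 i1; rewrite -!val_eqE /=; case: (nat_of_ord i) => [|[|]].
  have ir := ltnW (ltn_ord i).
  by rewrite base_shiftS ?(ltnW i1) // jx_shift // gtn_eqF // addr0.
set F := fun q => _.
have -> : 'D_Et F q = 'D_e0 (f^~ (jx q 1)) (base q).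
  by apply: derive_shift_eq => h; rewrite /F base_shiftt jx_shiftt.
have -> : 'D_(E 0) F q = 'D_e1 (f^~ (jx q 1)) (base q).
  by apply: derive_shift_eq => h; rewrite /F base_shift0 jx_shift // addr0.
have -> : 'D_(E 1) F q = 'D_1 (f (base q)) (jx q 1).
  apply: derive_shift_eq => h; rewrite /F base_shiftS ?r0 // jx_shift // eqxx.
  by rewrite [_ *: 1]mulr1 [h + _]addrC.
by rewrite addrA.
Qed.

Lemma DtTE tau q : (1 < r)%N ->
  DtT tau q = 'D_e0 (fun p => tau p ord0 ord0) (base q) +
              jx q 1 * 'D_e1 (fun p => tau p ord0 ord0) (base q).
Proof.
move=> r1; rewrite /DtT.
rewrite [LHS](total_derivative_order1 (fun p _ => tau p ord0 ord0) q r1).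
by rewrite [X in _ + _ * X]derive_eq0 // mulr0 addr0.
Qed.

Lemma prolong_coord1E tau q : (1 < r)%N ->
  prolong_coord tau 1 q =
  ('D_e0 (fun p => tau p ord0 ord_max) (base q) +
   jx q 1 * 'D_e1 (fun p => tau p ord0 ord_max) (base q)) / DtT tau q.
Proof.
move=> r1; congr (_ / _).
rewrite [LHS](total_derivative_order1 (fun p _ => tau p ord0 ord_max) q r1).
by rewrite [X in _ + _ * X]derive_eq0 // mulr0 addr0.
Qed.

Definition jacobian_det tau (p : 'rV[K]_2) :=
  'D_e0 (fun p => tau p ord0 ord0) p * 'D_e1 (fun p => tau p ord0 ord_max) p -
  'D_e1 (fun p => tau p ord0 ord0) p * 'D_e0 (fun p => tau p ord0 ord_max) p.

Lemma det_jacobian tau p : differentiable tau p ->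
  \det ('J tau p) = jacobian_det tau p.
Proof.
move=> dtau; rewrite det_mx22 /jacobian !mxE /jacobian_det !derive_coord //.
by rewrite !deriveE // [X in _ - X]mulrC.
Qed.

Lemma DtT_shift tau j (h : K) q : (1 < r)%N -> (1 < j <= r)%N ->
  DtT tau (h *: E j + q) = DtT tau q.
Proof.
move=> r1 /andP[j1 jr].
by rewrite !DtTE // base_shiftS ?(ltnW j1) // jx_shift ?(ltnW r1) // gtn_eqF // addr0.
Qed.

Lemma prolong_coordS tau k q :
  prolong_coord tau k.+1 q = total_derivative (prolong_coord tau k) q / DtT tau q.
Proof. by []. Qed.

Lemma prolong_coord_shift tau k j (h : K) q : (1 < r)%N -> (k < j <= r)%N ->
  prolong_coord tau k (h *: E j + q) = prolong_coord tau k q.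
Proof.
move=> r1; elim: k j h q => [|k IH] j h q /andP[kj jr] /=.
  by rewrite base_shiftS // kj jr.
rewrite DtT_shift // ?jr ?(leq_ltn_trans _ kj) // (@total_derivative_shift _ k).
- by rewrite gtn_eqF // addr0.
- by move=> i h' q' ir; exact: IH.
- by rewrite (ltnW kj).
Qed.

(** By induction: D_t hands the slope in x^(k) over to x^(k+1), and the division by D_t T
    contributes one more factor. The start is k = 1, where D_t T itself depends on x^(1); at k = 0
    the slope would be X_x. *)
Lemma derive_prolong_coord tau k q : (1 < r)%N -> (0 < k <= r)%N ->
  DtT tau q != 0 ->
  'D_(E k) (prolong_coord tau k) q = jacobian_det tau (base q) / DtT tau q ^+ k.+1.
Proof.
move=> r1; case: k => // k /andP[_]; elim: k q => [|k IH] q kr Dq.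
  pose a := 'D_e0 (fun p => tau p ord0 ord_max) (base q).
  pose b := 'D_e1 (fun p => tau p ord0 ord_max) (base q).
  pose c := 'D_e0 (fun p => tau p ord0 ord0) (base q).
  pose d := 'D_e1 (fun p => tau p ord0 ord0) (base q).
  have Dq' : c + jx q 1 * d != 0 by move: Dq; rewrite DtTE.
  have -> : jacobian_det tau (base q) = b * c - a * d by rewrite /jacobian_det mulrC [_ * a]mulrC.
  rewrite DtTE // -/c -/d -(@derive_val _ _ _ _ _ _ _ (is_derive_moebius a b Dq')).
  apply: derive_shift_eq => h; rewrite !prolong_coord1E // !DtTE //.
  by rewrite base_shiftS ?kr // jx_shift // eqxx [_ *: 1]mulr1 [h + _]addrC.
rewrite (@derive_affine _ _ _ _ _ _ ('D_(E k.+1) (prolong_coord tau k.+1) q / DtT tau q)); last first.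
  move=> h; rewrite !(prolong_coordS _ k.+1) DtT_shift ?kr //.
  rewrite (@total_derivative_shift _ k.+1) ?ltnSn ?kr //; last first.
    by move=> *; exact: prolong_coord_shift.
  by rewrite eqxx mulrDl -mulrA.
by rewrite IH ?(ltnW kr) // -mulrA -invfM -exprSr.
Qed.

End JetCalculus.

(** * Prolongation of fibre-linear transformations *)

(* For t~ = s(t), x~ = m(t) x + g(t) and w = 1 / s', x~^(k) is the sum of the
   prolong_coef m w k j x^(j) over j <= k and of prolong_rest g w k. *)
Fixpoint prolong_coef (K : numFieldType) (m w : K -> K) (k j : nat) : K -> K :=
  if k is k'.+1 then fun t =>
    w t * ('D_1 (prolong_coef m w k' j) t +
           if j is j'.+1 then prolong_coef m w k' j' t else 0)
  else fun t => if j is 0 then m t else 0.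

Fixpoint prolong_rest (K : numFieldType) (g w : K -> K) (k : nat) : K -> K :=
  if k is k'.+1 then fun t => w t * 'D_1 (prolong_rest g w k') t else g.

Section FibreLinear.
Context {K : numFieldType}.
Variables (I : set K) (m w g : K -> K).
Hypotheses (openI : open I) (sm : smooth_on I m) (sw : smooth_on I w)
  (sg : smooth_on I g).

Lemma prolong_coef_smooth k j : smooth_on I (prolong_coef m w k j).
Proof.
elim: k j => [|k IH] [|j] n //=; first exact: Cn_on_cst.
- apply: Cn_onM => //; apply: (Cn_onD openI _ (Cn_on_cst openI n (0 : K))).
  exact: smooth_on_derive.
- by apply: Cn_onM => //; apply: Cn_onD => //; [exact: smooth_on_derive|exact: IH].
Qed.

Lemma prolong_rest_smooth k : smooth_on I (prolong_rest g w k).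
Proof.
elim: k => [|k IH] n //=; apply: Cn_onM => //; exact: smooth_on_derive.
Qed.

Lemma derive_near0 (f : K -> K) t : (forall t, I t -> f t = 0) -> I t -> 'D_1 f t = 0.
Proof.
move=> f0 It; rewrite (near_eq_derive (g := cst 0)) ?derive_cst //.
exact: (open_near_eq openI).
Qed.

Lemma prolong_coef_gt k j t : (k < j)%N -> I t -> prolong_coef m w k j t = 0.
Proof.
elim: k j t => [|k IH] [|j] t //= kj It.
rewrite (derive_near0 (f := prolong_coef m w k j.+1)) ?IH ?addr0 ?mulr0 //.
by move=> u Iu; rewrite IH // ltnW.
Qed.

End FibreLinear.

Section FibreLinearProlongation.
Context {K : numFieldType} {r : nat}.
Implicit Types (q : jet K r).
Local Notation e0 := (delta_mx ord0 ord0 : 'rV[K]_2).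
Local Notation e1 := (delta_mx ord0 ord_max : 'rV[K]_2).
Local Notation E k := (delta_mx ord0 (jx_idx k) : jet K r).
Local Notation Et := (delta_mx ord0 jt_idx : jet K r).

Lemma total_derivative_near_eq (F G : jet K r -> K) q :
  {near q, F =1 G} -> total_derivative F q = total_derivative G q.
Proof.
move=> FG; rewrite /total_derivative (near_eq_derive _ FG); congr (_ + _).
by apply: eq_bigr => i _; rewrite (near_eq_derive _ FG).
Qed.

Lemma near_base (Om : set 'rV[K]_2) q : open Om -> Om (base q) ->
  \forall z \near q, Om (base z).
Proof.
move=> oO Oq; apply: (@continuous_lsubmx K 1 2 r q).
exact: open_nbhs_nbhs.
Qed.

Lemma jt_shiftt (h : K) q : jt (h *: Et + q) = h + jt q.
Proof. by rewrite /jt !mxE !eqxx mulr1. Qed.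

Lemma jt_shiftx k (h : K) q : (k <= r)%N -> jt (h *: E k + q) = jt q.
Proof.
by move=> kr; rewrite /jt !mxE eqxx -val_eqE /= inordK ?ltnS // mulr0 add0r.
Qed.

(** Product rule: the t-derivative acts on the coefficients, while x^(k+1) d_(x^(k)) moves the
    coefficient [a k] to the index k + 1. With [a r] zero at [jt q], the truncation of D_t loses no
    term. *)
Lemma total_derivative_linear (a : nat -> K -> K) (b : K -> K) q :
  (forall j, derivable (a j) (jt q) 1) -> derivable b (jt q) 1 ->
  a r (jt q) = 0 ->
  total_derivative (fun q => \sum_(j < r.+1) a j (jt q) * jx q j + b (jt q)) q =
  \sum_(j < r.+1) ('D_1 (a j) (jt q) + if nat_of_ord j is j'.+1 then a j' (jt q) else 0) * jx q j
  + 'D_1 b (jt q).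
Proof.
move=> da db ar0; set F := fun q => _.
have -> : total_derivative F q = \sum_(j < r.+1) 'D_1 (a j) (jt q) * jx q j + 'D_1 b (jt q)
    + \sum_(j < r) jx q j.+1 * a j (jt q).
  rewrite /total_derivative; congr (_ + _).
    pose f (j : 'I_r.+1) (z : K) := jx q j * a j z.
    have df j : derivable (f j) (jt q) 1 by apply: derivableM; [exact: derivable_cst|exact: da].
    have dE : 'D_Et F q = 'D_1 (\sum_j f j + b) (jt q).
      apply: derive_shift_eq => h; rewrite /F !fctE !fct_sumE jt_shiftt.
      rewrite [_ *: 1]mulr1; congr (_ + _ - (_ + _)); apply: eq_bigr => i _.
        by rewrite jx_shiftt ?(leq_ord i) // [RHS]mulrC.
      by rewrite [RHS]mulrC.
    rewrite dE deriveD //; last exact: derivable_sum.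
    rewrite derive_sum //; congr (_ + _); apply: eq_bigr => i _.
    by rewrite /f deriveMl // mulrC.
  apply: eq_bigr => i _; congr (_ * _); apply: derive_affine => h.
  have ir := ltn_ord i; rewrite /F jt_shiftx ?(ltnW ir) //.
  rewrite addrAC; congr (_ + _).
  rewrite (bigD1 (widen_ord (leqnSn r) i)) //= [in RHS](bigD1 (widen_ord (leqnSn r) i)) //=.
  rewrite jx_shift ?(ltnW ir) // eqxx mulrDr -!addrA; congr (_ + _).
  rewrite addrC mulrC; congr (_ + _); apply: eq_bigr => j ji.
  rewrite jx_shift ?(ltnW ir) ?leq_ord // [_ == _](_ : _ = false) ?addr0 //.
  by apply: contraNF ji => /eqP ij; apply/eqP/val_inj.
rewrite addrAC; congr (_ + _).
under [in RHS]eq_bigr do rewrite mulrDl.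
rewrite big_split /=; congr (_ + _).
rewrite [in RHS]big_ord_recl mul0r add0r; apply: eq_bigr => i _.
by rewrite mulrC.
Qed.

Section FibreLinearTransformation.
Variables (tau : 'rV[K]_2 -> 'rV[K]_2) (Om : set 'rV[K]_2) (I : set K).
Variables (s m g : K -> K).
Hypotheses (r1 : (1 < r)%N) (openOm : open Om) (openI : open I)
  (OmI : forall p, Om p -> I (p ord0 ord0))
  (ss : smooth_on I s) (sm : smooth_on I m) (sg : smooth_on I g)
  (s'0 : forall t, I t -> 'D_1 s t != 0)
  (tau0 : forall p, Om p -> tau p ord0 ord0 = s (p ord0 ord0))
  (tau1 : forall p, Om p ->
    tau p ord0 ord_max = m (p ord0 ord0) * p ord0 ord_max + g (p ord0 ord0)).

Let w t := ('D_1 s t)^-1.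

Let sw : smooth_on I w.
Proof. by move=> n; apply: Cn_onV => //; exact: smooth_on_derive. Qed.

Lemma DtT_fibre_preserving q : Om (base q) -> DtT tau q = 'D_1 s (jt q).
Proof.
move=> Oq; rewrite DtTE //.
have nE := open_near_eq openOm tau0 Oq.
rewrite (near_eq_derive e0 nE) (near_eq_derive e1 nE).
rewrite [X in _ + _ * X]derive_eq0 ?mulr0 ?addr0.
  by apply: derive_shift_eq => h; rewrite jtE !mxE !eqxx mulr1 [_ *: 1]mulr1.
by move=> h; rewrite !mxE mulr0 add0r.
Qed.

Lemma prolong_coord_fibre_linear k q : (k <= r)%N -> Om (base q) ->
  prolong_coord tau k q =
  \sum_(j < r.+1) prolong_coef m w k j (jt q) * jx q j + prolong_rest g w k (jt q).
Proof.
elim: k q => [|k IH] q kr Oq.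
  rewrite [LHS]tau1 // -jtE -jx0E big_ord_recl big1 ?addr0 // => i _.
  by rewrite mul0r.
rewrite prolong_coordS DtT_fibre_preserving //.
(* The induction hypothesis is only available over [Om]; openness makes it hold near [q], which
   suffices for D_t. *)
rewrite (@total_derivative_near_eq _ (fun q =>
  \sum_(j < r.+1) prolong_coef m w k j (jt q) * jx q j + prolong_rest g w k (jt q))); last first.
  by have := near_base openOm Oq; apply: filterS => z Oz; rewrite IH ?(ltnW kr).
have It : I (jt q) by rewrite jtE; exact: OmI.
rewrite total_derivative_linear.
- rewrite mulrC mulrDr mulr_sumr; congr (_ + _); apply: eq_bigr => j _.
  by rewrite mulrA.
- move=> j; apply: diff_derivable; apply: smooth_on_differentiable It.
  exact: prolong_coef_smooth.
- apply: diff_derivable; apply: smooth_on_differentiable It.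
  exact: prolong_rest_smooth.
- exact: prolong_coef_gt openI _ _ _ kr It.
Qed.

End FibreLinearTransformation.
End FibreLinearProlongation.

(** * Fibre-linear transformations preserving x^(r) = 0 *)

Section Incompatibility.
Context {K : numFieldType}.
Variables (I : set K) (a : K) (w : K -> K) (r : nat).
Hypotheses (openI : open I) (I0 : forall t, I t -> t != 0) (a0 : a != 0)
  (sw : smooth_on I w) (w0 : forall t, I t -> w t != 0) (r3 : (3 <= r)%N).

Let m (t : K) := a * t^-1.
Let A := prolong_coef m w.

Lemma is_derive_expr (f : K -> K) (t df : K) n :
  is_derive t 1 f df -> is_derive t 1 (fun z : K => f z ^+ n) (n%:R * f t ^+ n.-1 * df).
Proof.
case: n => [|n] fdf.
  by rewrite mul0r mul0r; exact: is_derive_cst.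
have -> : (fun z : K => f z ^+ n.+1) = f ^+ n.+1 by apply/funext => z; rewrite fctE.
exact: is_deriveX.
Qed.

(** The coefficients to be differentiated below are brought to this monomial form. For n = 0 the
    exponent [n.-1] is harmless, its term having the factor [n%:R = 0]. *)
Lemma derive_monomial (b : K) i n t : I t ->
  'D_1 (fun z : K => b * z^-1 ^+ i * w z ^+ n) t =
  b * (n%:R * t^-1 ^+ i * w t ^+ n.-1 * 'D_1 w t - i%:R * t^-1 ^+ i.+1 * w t ^+ n).
Proof.
move=> It; have t0 := I0 It.
have dw : is_derive t 1 w ('D_1 w t).
  by split => //; apply: diff_derivable; exact: smooth_on_differentiable It.
have di : is_derive t 1 (fun z : K => z^-1) (- t ^- 2).
  by split; [exact: derivableV|rewrite deriveV // derive_id [_ *: _]mulr1].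
have [dwn Dwn] := is_derive_expr n dw.
have [din Din] := is_derive_expr i di.
have db := derivableM (derivable_cst b t 1) din.
rewrite [LHS](deriveM db dwn) [X in _ + _ *: X](deriveM (derivable_cst b t 1) din).
rewrite derive_cst Dwn Din !fctE /GRing.scale /=.
case: i {Din din db} => [|i] /=; first by rewrite expr0; ring.
by rewrite -(exprVn t 2) !exprS expr0; ring.
Qed.

Lemma derive_ext (f g : K -> K) t : (forall t, I t -> f t = g t) -> I t ->
  'D_1 f t = 'D_1 g t.
Proof. by move=> fg It; apply: near_eq_derive; exact: (open_near_eq openI). Qed.

Let AS0 k t : A k.+1 0 t = w t * 'D_1 (A k 0) t.
Proof. by rewrite /A /= addr0. Qed.

Let ASS k j t : A k.+1 j.+1 t = w t * ('D_1 (A k j.+1) t + A k j t).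
Proof. by []. Qed.

(** The exponent in [t^-1 ^+ 1] is kept so that [derive_monomial] applies verbatim. *)
Lemma prolong_coef_diag k t : I t -> A k k t = a * t^-1 ^+ 1 * w t ^+ k.
Proof.
elim: k t => [|k IH] t It; first by rewrite expr1 expr0 mulr1.
rewrite ASS (derive_ext (f := A k k.+1) (g := cst 0)) //; last first.
  by move=> u Iu; rewrite /A (@prolong_coef_gt _ I).
by rewrite derive_cst add0r IH // [w t ^+ k.+1]exprS mulrCA.
Qed.

(** The derivative of the diagonal coefficient A_(k,k) adds k w' - w / t to the last bracket;
    summing over the recursion gives the binomial coefficient. *)
Lemma prolong_coef_subdiag k t : I t ->
  A k.+1 k t = a * t^-1 * w t ^+ k * ('C(k.+1, 2)%:R * 'D_1 w t - k.+1%:R * w t / t).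
Proof.
elim: k t => [|k IH] t It; have t0 := I0 It.
  rewrite AS0 (derive_ext (@prolong_coef_diag 0)) // derive_monomial //.
  by rewrite bin_small // !exprS expr0; field.
rewrite ASS IH // (derive_ext (@prolong_coef_diag k.+1)) // derive_monomial //.
have -> : 'C(k.+2, 2)%:R = 'C(k.+1, 2)%:R + k.+1%:R :> K by rewrite binS bin1 natrD.
by rewrite !exprS expr0 -!natr1; field.
Qed.

Hypothesis A0 : forall j t, (0 < j < r)%N -> I t -> A r j t = 0.

Let beta : K := 2 / (r.-1)%:R.

Let r0 : (r.-1)%:R != 0 :> K.
Proof. by rewrite pnatr_eq0; case: r r3 => [|[|]]. Qed.

Let bin2E n : 'C(n.+1, 2)%:R = n.+1%:R * n%:R / 2 :> K.
Proof.
have := mul_bin_diag n.+1 1; rewrite bin1 /= => /(congr1 (fun n => n%:R : K)).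
rewrite !natrM => ->; rewrite mulrAC divff ?mul1r ?pnatr_eq0 //.
Qed.

(** [beta] is the constant forced by A_(r,r-1) = 0: the bracket of that coefficient reads r (r-1) w'
    / 2 = r w / t, its other factors being nonzero. *)
Lemma derive_w t : I t -> 'D_1 w t = beta * w t * t^-1.
Proof.
move=> It; have [t0 wt0] := (I0 It, w0 It).
have [n rE] : exists n, r = n.+1 by exists r.-1; case: r r3.
have n0 : n%:R != 0 :> K by move: r0; rewrite rE.
have n1 : n.+1%:R != 0 :> K by rewrite pnatr_eq0.
have : A r n t = 0 by apply: A0 => //; lia.
rewrite rE prolong_coef_subdiag // => /eqP; rewrite mulf_eq0 => /orP[|].
  by rewrite !mulf_eq0 invr_eq0 (negPf a0) (negPf t0) expf_eq0 (negPf wt0) andbF.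
rewrite subr_eq0 bin2E /beta rE /= => /eqP wE.
have nn0 : n.+1%:R * n%:R / 2 != 0 :> K.
  by rewrite !mulf_neq0 // invr_neq0 // pnatr_eq0.
by apply: (mulfI nn0); rewrite wE; field; rewrite t0 n0.
Qed.

(** With w' = beta w / t, the entry A_(k+1,k) is a nonpositive multiple of a t^-2 w^(k+1) for k <= r
    - 1, and differentiating t^-2 w^(k+1) gives the factor (k+1) beta - 2, nonpositive for k + 1 <=
    r - 1. Hence every step of the recursion adds a nonnegative amount to the initial c = 2 - beta,
    which is positive because r >= 3. *)
Lemma prolong_coef_subsubdiag k : (k.+2 <= r)%N ->
  exists2 c : K, 0 < c & forall t, I t -> A k.+2 k t = c * a * t^-1 ^+ 3 * w t ^+ k.+2.
Proof.
have n_gt0 : 0 < (r.-1)%:R :> K by rewrite ltr0n; case: r r3 => [|[|]].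
have subdiag k' t : I t -> A k'.+1 k' t =
    (k'.+1%:R * (k'%:R / (r.-1)%:R - 1) * a) * t^-1 ^+ 2 * w t ^+ k'.+1.
  move=> It; have t0 := I0 It.
  rewrite prolong_coef_subdiag // derive_w // bin2E /beta !exprS expr0 -!natr1.
  by field; rewrite t0 r0.
elim: k => [|k IH] kr.
  exists (2 - beta).
    rewrite subr_gt0 /beta ltr_pdivrMr // ltr_pMr ?ltr0n // ltr1n.
    by case: r r3 => [|[|[|]]].
  move=> t It; have t0 := I0 It; rewrite AS0 (derive_ext (@subdiag 0)) // derive_monomial //.
  rewrite derive_w // /beta !exprS expr0.
  by field; rewrite t0 r0.
have [c c0 Ac] := IH (ltnW kr).
pose n := (r.-1)%:R : K; pose j := k.+2%:R : K.
(* Here j = k + 2 is the power of [w] being differentiated, and n = r - 1 is at least j. *)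
exists (c + j * (2 * (n - j) * (n + 1 - j)) / n ^+ 2).
  apply: ltr_wpDr => //.
  apply: divr_ge0; last exact/exprn_ge0/ltW.
  have [l rE] : exists l, r = (k.+3 + l)%N by exists (r - k.+3)%N; lia.
  have -> : n = j + l%:R by rewrite /j /n rE /= -natrD.
  have -> : j * (2 * (j + l%:R - j) * (j + l%:R + 1 - j)) = (k.+2 * (2 * l * l.+1))%:R.
    by rewrite !natrM -[l.+1%:R]natr1 /j; ring.
  exact: ler0n.
move=> t It; have t0 := I0 It; rewrite ASS Ac // (derive_ext (@subdiag k.+1)) //.
rewrite derive_monomial // derive_w // /beta !exprS expr0 /n /j -!natr1.
by field; rewrite t0 r0.
Qed.

(** As r >= 3, the index r - 2 is positive, so A_(r,r-2) is among the coefficients required to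
    vanish, against [prolong_coef_subsubdiag]. *)
Lemma no_symmetry t : ~ I t.
Proof.
move=> It; have [n rE] : exists n, r = n.+3 by exists r.-2.-1; case: r r3 => [|[|[|]]].
have [|c c0 Ac] := @prolong_coef_subsubdiag n.+1; first by rewrite rE.
have := @A0 n.+1 t; rewrite rE leqnSn Ac // => /(_ isT It)/eqP.
apply/negP; apply: mulf_neq0; last exact/expf_neq0/w0.
apply: mulf_neq0; last exact/expf_neq0/invr_neq0/I0.
by apply: mulf_neq0 => //; rewrite gt_eqF.
Qed.

End Incompatibility.

(** * Equivalence transformations *)

Lemma horner_eq0_poly0 (K : numFieldType) (p : {poly K}) :
  (forall u, u != 0 -> p.[u] = 0) -> p = 0.
Proof.
move=> p0; apply/eqP/contraT => pN0.
(* The integers 1, ..., [size p] are distinct and nonzero in characteristic 0: one root too many. *)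
pose s := [seq (i.+1)%:R : K | i <- iota 0 (size p)].
have sp : all (root p) s.
  by apply/allP => _ /mapP[i _ ->]; rewrite rootE p0 // pnatr_eq0.
have us : uniq s.
  by rewrite map_inj_uniq ?iota_uniq // => i j /eqP; rewrite eqr_nat eqSS => /eqP.
by have := max_poly_roots pN0 sp us; rewrite size_map size_iota ltnn.
Qed.

(** If b were nonzero, put x = z + u with z = - a / b, so that a + x b = u b, and clear
    denominators: (z + u) D equals u^r times a polynomial in u. As r > 1, the coefficient of u is D
    on one side and 0 on the other. The constant coefficient would not do, since z may vanish. *)
Lemma moebius_pole (K : numFieldType) (a b c d g h : K) r : (1 < r)%N ->
  a * d - b * c != 0 ->
  (forall x, a + x * b != 0 ->
    x * ((a * d - b * c) / (a + x * b) ^+ r.+1) = g * ((c + x * d) / (a + x * b)) + h) ->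
  b = 0.
Proof.
move=> r1; set D := a * d - b * c => D0 H; apply/eqP/contraT => b0.
pose z := - a / b.
pose P := (z%:P + 'X) * D%:P - ((g * (c + z * d))%:P + 'X * (g * d + h * b)%:P) * (b ^+ r)%:P * 'X^r.
have P0 : P = 0.
  apply: horner_eq0_poly0 => u u0.
  have E : a + (z + u) * b = u * b by rewrite /z; field.
  have := H (z + u); rewrite E mulf_neq0 // => /(_ isT) Hu.
  rewrite /P !hornerE.
  have {}Hu : (z + u) * D = (g * (c + (z + u) * d) + h * (u * b)) * (u * b) ^+ r.
    have ub : u * b != 0 by rewrite mulf_neq0.
    apply: (mulIf (invr_neq0 (expf_neq0 r.+1 ub))).
    by rewrite -mulrA Hu exprS; field; rewrite expf_neq0 // u0 b0.
  by rewrite Hu exprMn; ring.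
have := congr1 (fun p : {poly K} => p`_1) P0.
rewrite /P coefB coefMXn r1 subr0 coefMC coefD coefX coefC coef0 add0r mul1r => D0'.
by rewrite D0' eqxx in D0.
Qed.

Section Incidence.
Context {K : numFieldType} {r : nat}.
Variable (r3 : (3 <= r)%N).
Implicit Types (q : jet K r) (p : 'rV[K]_2).
Local Notation e0 := (delta_mx ord0 ord0 : 'rV[K]_2).
Local Notation e1 := (delta_mx ord0 ord_max : 'rV[K]_2).
Local Notation E k := (delta_mx ord0 (jx_idx k) : jet K r).

Let r1 : (1 < r)%N := ltnW r3.

Lemma prolong_coord_affine tau k (h : K) q : (0 < k < r)%N -> DtT tau q != 0 ->
  prolong_coord tau k.+1 (h *: E k.+1 + q) =
  prolong_coord tau k.+1 q + h * (jacobian_det tau (base q) / DtT tau q ^+ k.+2).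
Proof.
move=> /andP[k0 kr] Dq; rewrite !prolong_coordS DtT_shift ?ltnS ?k0 //.
rewrite (@total_derivative_shift _ _ _ k) ?ltnSn ?kr //; last first.
  by move=> *; exact: prolong_coord_shift.
rewrite eqxx mulrDl mulrA -mulrA derive_prolong_coord ?k0 ?(ltnW kr) //.
by rewrite [_ ^+ k.+2]exprSr invfM !mulrA.
Qed.

(** The value [f 0] is ignored: x is taken from [p]. *)
Definition mkjet p (f : nat -> K) : jet K r :=
  row_mx p (\row_(k < r) f k.+1).

Lemma base_mkjet p f : base (mkjet p f) = p.
Proof. by rewrite /base row_mxKl. Qed.

Lemma jx_mkjet p f k : (0 < k <= r)%N -> jx (mkjet p f) k = f k.
Proof.
case: k => // k kr; rewrite /jx /mkjet.
have -> : jx_idx k.+1 = rshift 2 (Ordinal kr) by apply: val_inj; rewrite /= inordK.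
by rewrite row_mxEr mxE.
Qed.

(* The relation obtained by subtracting the images of two equations with constant
   parameters that differ only in the coefficient of x^(j). *)
Definition incidence (tau : 'rV[K]_2 -> 'rV[K]_2) (Om : set 'rV[K]_2) (j : nat) :=
  exists (g : K -> nat -> K) (h : K -> K), forall q, Om (base q) -> DtT tau q != 0 ->
    let u := tau (base q) ord0 ord0 in
    jx q j * (jacobian_det tau (base q) / DtT tau q ^+ r.+1) =
    \sum_(k < r.-1) g u k * prolong_coord tau k.+1 q + h u.

Lemma exists_DtT_neq0 tau p : jacobian_det tau p != 0 ->
  exists x,
    'D_e0 (fun p => tau p ord0 ord0) p + x * 'D_e1 (fun p => tau p ord0 ord0) p != 0.
Proof.
rewrite /jacobian_det; set a := 'D_e0 _ p; set b := 'D_e1 _ p.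
have [a0|a0 _] := eqVneq a 0; last by exists 0; rewrite mul0r addr0.
rewrite a0 mul0r sub0r oppr_eq0 mulf_eq0 negb_or => /andP[b0 _].
by exists 1; rewrite mul1r add0r.
Qed.

(** Downward induction on i, where [g i] multiplies x~^(i+1). Raising x^(i+1) by 1 changes neither
    the left side, as i + 1 > j, nor the x~^(k+1) with k < i; the terms with k > i are zero already.
    So the increment g_i J / D^(i+2) of the remaining term vanishes. *)
Lemma incidence_elim tau p j (g : nat -> K) (h : K) : (0 < j)%N ->
  jacobian_det tau p != 0 ->
  (forall q, base q = p -> DtT tau q != 0 ->
    jx q j * (jacobian_det tau p / DtT tau q ^+ r.+1) =
    \sum_(k < r.-1) g k * prolong_coord tau k.+1 q + h) ->
  forall i, (j <= i < r.-1)%N -> g i = 0.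
Proof.
move=> j0 D0 H i; have [n] := ubnP (r.-1 - i); elim: n i => // n IH i.
rewrite ltnS => ni /andP[ji ir].
have g0 l : (i < l < r.-1)%N -> g l = 0.
  by move=> /andP[il lr]; apply: IH; lia.
have [x x0] := exists_DtT_neq0 D0.
pose q := mkjet p (fun=> x).
have Dq : DtT tau q != 0 by rewrite DtTE // base_mkjet jx_mkjet ?(ltnW r1).
have := H (1 *: E i.+1 + q).
have ir' : (i.+1 <= r)%N by lia.
rewrite base_shiftS ?ir' // DtT_shift ?ltnS ?(leq_trans j0 ji) // base_mkjet.
move=> /(_ erefl Dq); rewrite jx_shift //; last by lia.
rewrite [_ == _](_ : _ = false) ?addr0; last by lia.
rewrite H ?base_mkjet // => /addIr.
have split q' : \sum_(k < r.-1) g k * prolong_coord tau k.+1 q' =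
    g i * prolong_coord tau i.+1 q' +
    \sum_(k < r.-1 | k != Ordinal ir) g k * prolong_coord tau k.+1 q'.
  by rewrite (bigD1 (Ordinal ir)).
rewrite !split.
rewrite prolong_coord_affine // ?(leq_trans j0 ji) // mulrDr mul1r -addrA.
move=> /addrI.
rewrite [X in X = _](_ : _ = \sum_(k < r.-1 | k != Ordinal ir) g k * prolong_coord tau k.+1 (1 *: E i.+1 + q)).
  rewrite -[LHS]add0r => /addIr/esym/eqP.
  rewrite base_mkjet !mulf_eq0 invr_eq0 (negPf D0) expf_eq0 (negPf Dq) andbF !orbF.
  by move/eqP.
apply: eq_bigr => k kI.
case: (ltngtP k i) => [ki|ik|eki]; last by case/eqP: kI; exact: val_inj.
  by rewrite prolong_coord_shift // ltnS ki.
by rewrite g0 ?mul0r // ik ltn_ord.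
Qed.

End Incidence.

Lemma sum_leading (K : nzRingType) n l (G F : nat -> K) :
  (forall k, (l <= k < n)%N -> G k = 0) -> (l <= n)%N ->
  \sum_(k < n) G k * F k = \sum_(k < l) G k * F k.
Proof.
move=> G0 ln; rewrite [RHS](big_ord_widen _ (fun k => G k * F k) ln) /= [RHS]big_mkcond /=.
by apply: eq_bigr => k _; case: ltnP => // lk; rewrite G0 ?mul0r // lk ltn_ord.
Qed.

(** The second difference at -1, 0, 1 isolates the leading coefficient g h / c. *)
Lemma quadratic_vanishing (K : numFieldType) (a b b' c u v u' v' g h : K) :
  c != 0 -> g != 0 ->
  (forall x, 0 = a * (u + x * v) + g * ((b + x * u' + x * (v' + x * h)) / c) + b') ->
  h = 0.
Proof.
move=> c0 g0 H; have two0 : 2 != 0 :> K by rewrite pnatr_eq0.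
apply: (mulfI g0); apply: (mulIf (invr_neq0 c0)); apply: (mulfI two0).
rewrite mulr0 mul0r mulr0.
pose A x := a * (u + x * v) + g * ((b + x * u' + x * (v' + x * h)) / c) + b'.
have -> : 2 * (g * h / c) = A 1 + A (-1) - A 0 * 2 by rewrite /A; field.
by rewrite /A -!H mul0r subr0 addr0.
Qed.

Section IncidenceConsequences.
Context {K : numFieldType} {r : nat}.
Variables (tau : 'rV[K]_2 -> 'rV[K]_2) (Om : set 'rV[K]_2).
Hypotheses (r3 : (3 <= r)%N) (openOm : open Om) (stau : smooth_on Om tau)
  (D0 : forall p, Om p -> jacobian_det tau p != 0).
Implicit Types (q : jet K r) (p : 'rV[K]_2).
Local Notation e0 := (delta_mx ord0 ord0 : 'rV[K]_2).
Local Notation e1 := (delta_mx ord0 ord_max : 'rV[K]_2).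
Local Notation T := (fun p => tau p ord0 ord0).
Local Notation X := (fun p => tau p ord0 ord_max).

Let r1 : (1 < r)%N := ltnW r3.
Let r0 : (0 < r)%N := ltnW r1.

(** Only g_0 survives, so over a fixed (t, x) the relation is one between rational functions of
    x^(1): [moebius_pole] gives T_x = 0, and what remains is affine in x^(1). *)
Lemma incidence_order1 : incidence (r := r) tau Om 1 ->
  (forall p, Om p -> 'D_e1 T p = 0) /\
  exists phi : K -> K, forall p, Om p -> 'D_e0 X p = phi (T p) * 'D_e0 T p.
Proof.
move=> [g [h H]].
have i0 : (0 < r.-1)%N by lia.
have H1 p x : Om p -> 'D_e0 T p + x * 'D_e1 T p != 0 ->
    x * (('D_e0 T p * 'D_e1 X p - 'D_e1 T p * 'D_e0 X p) / ('D_e0 T p + x * 'D_e1 T p) ^+ r.+1) =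
    g (T p) 0 * (('D_e0 X p + x * 'D_e1 X p) / ('D_e0 T p + x * 'D_e1 T p)) + h (T p).
  move=> Op Dx; pose q : jet K r := mkjet p (fun=> x).
  have bq : base q = p by rewrite base_mkjet.
  have qx : jx q 1 = x by rewrite jx_mkjet ?r0.
  have DqE : DtT tau q = 'D_e0 T p + x * 'D_e1 T p by rewrite DtTE // bq qx.
  have := H q; rewrite bq DqE => /(_ Op Dx) Hq.
  rewrite qx in Hq; rewrite -/(jacobian_det tau p) Hq.
  rewrite (@sum_leading _ _ 1 _ (fun k => prolong_coord tau k.+1 q)) //.
    by rewrite big_ord1 prolong_coord1E // bq qx DqE.
  apply: (incidence_elim (tau := tau) (p := p) (h := h (T p)) r3) => //; first exact: D0.
  by move=> q' bq' Dq'; have := H q'; rewrite bq' => /(_ Op Dq').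
have Tx0 p : Om p -> 'D_e1 T p = 0.
  move=> Op; apply: (moebius_pole r1 (D0 Op)) => x.
  exact: H1.
(* The constant term in x^(1) reads g_0 X_t / T_t + h = 0, which dictates this function of T. *)
split=> //; exists (fun u => - h u / g u 0%N) => p Op.
have := D0 Op; rewrite /jacobian_det (Tx0 _ Op) mul0r subr0 mulf_eq0 negb_or => /andP[Tt Xx].
have := H1 p 0 Op; have := H1 p 1 Op.
rewrite (Tx0 _ Op) !(mul0r, mul1r, mulr0, addr0, subr0) => /(_ Tt) E1 /(_ Tt) E0.
(* If g_0 were 0, the relations at x^(1) = 0 and x^(1) = 1 would have the same right side, whence J
   = 0. *)
have gN0 : g (T p) 0%N != 0.
  have : 'D_e0 T p * 'D_e1 X p / 'D_e0 T p ^+ r.+1 != 0.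
    by rewrite mulf_neq0 ?invr_neq0 ?expf_neq0 // mulf_neq0.
  apply: contraNneq => g0; have := E0; rewrite E1 g0 !mul0r !add0r => <-.
  exact: eqxx.
apply: (mulfI gN0).
have -> : g (T p) 0%N * (- h (T p) / g (T p) 0%N * 'D_e0 T p) = - h (T p) * 'D_e0 T p.
  by field.
by apply/eqP; rewrite mulNr -addr_eq0 -(mulfVK Tt (g _ _ * _)) -mulrDl -mulrA -E0 mul0r.
Qed.

(** Now x~^(1) = kap + x^(1) n, and the square of x^(1) enters x~^(2) with the factor n_x / T_t. The
    left side of the relation has no such square, and g_1 is nonzero because x^(2) occurs on the
    left. *)
Lemma incidence_order2 : (forall p, Om p -> 'D_e1 T p = 0) ->
  incidence (r := r) tau Om 2 ->
  forall p, Om p -> 'D_e1 (fun p => 'D_e1 X p / 'D_e0 T p) p = 0.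
Proof.
move=> Tx0 [g [h H]] p Op.
pose n p := 'D_e1 X p / 'D_e0 T p; pose kap p := 'D_e0 X p / 'D_e0 T p.
have Tt0 p' : Om p' -> 'D_e0 T p' != 0.
  by move=> Op'; have := D0 Op'; rewrite /jacobian_det Tx0 // mul0r subr0 mulf_eq0 negb_or => /andP[].
have DqE q : Om (base q) -> DtT tau q = 'D_e0 T (base q).
  by move=> Oq; rewrite DtTE // Tx0 // mulr0 addr0.
have y1E q : Om (base q) -> prolong_coord tau 1 q = kap (base q) + jx q 1 * n (base q).
  by move=> Oq; rewrite prolong_coord1E // DqE // mulrDl mulrA.
have dX v p' : Om p' -> differentiable ('D_v X) p'.
  move=> Op'; apply: smooth_on_differentiable Op'; apply: smooth_on_derive => k.
  exact: Cn_on_coord.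
have dT p' : Om p' -> differentiable ('D_e0 T) p'.
  move=> Op'; apply: smooth_on_differentiable Op'; apply: smooth_on_derive => k.
  exact: Cn_on_coord.
have dn v : derivable n p v.
  apply: diff_derivable; apply: differentiableM; first exact: dX.
  by apply: differentiableV; [exact: dT|exact: Tt0].
have dk v : derivable kap p v.
  apply: diff_derivable; apply: differentiableM; first exact: dX.
  by apply: differentiableV; [exact: dT|exact: Tt0].
have y2E x1 x2 : let q : jet K r := mkjet p (fun k => if k == 1 then x1 else x2) in
  prolong_coord tau 2 q =
  ('D_e0 kap p + x1 * 'D_e0 n p + x1 * ('D_e1 kap p + x1 * 'D_e1 n p) + x2 * n p) / 'D_e0 T p.
  move=> q; have bq : base q = p by rewrite base_mkjet.
  have q1 : jx q 1 = x1 by rewrite jx_mkjet ?r0.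
  have q2 : jx q 2 = x2 by rewrite jx_mkjet ?r1.
  have Oq : Om (base q) by rewrite bq.
  rewrite prolong_coordS DqE // bq; congr (_ / _).
  rewrite (@total_derivative_near_eq _ _ _ (fun q => kap (base q) + jx q 1 * n (base q))); last first.
    by have := near_base openOm Oq; apply: filterS => z Oz; rewrite y1E.
  rewrite (total_derivative_order1 (fun p x => kap p + x * n p)) // bq q1 q2.
  have DE v : 'D_v (fun p => kap p + x1 * n p) p = 'D_v kap p + x1 * 'D_v n p.
    have dxn : derivable (fun p => x1 * n p) p v.
      by apply: derivableM; [exact: derivable_cst|exact: dn].
    by rewrite [LHS](deriveD (dk v) dxn) (deriveMl _ (dn v)).
  have -> : 'D_1 (fun x : K => kap p + x * n p) x1 = n p.
    by apply: derive_affine => u; rewrite [_ *: 1]mulr1 mulrDl addrCA addrC.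
  by rewrite !DE.
pose c := jacobian_det tau p / 'D_e0 T p ^+ r.+1.
have c0 : c != 0 by rewrite mulf_neq0 ?invr_neq0 ?expf_neq0 ?Tt0 ?D0.
pose g0 := g (T p) 0%N; pose g1 := g (T p) 1%N.
have HE x1 x2 : x2 * c = g0 * (kap p + x1 * n p) + g1 *
    (('D_e0 kap p + x1 * 'D_e0 n p + x1 * ('D_e1 kap p + x1 * 'D_e1 n p) + x2 * n p) / 'D_e0 T p) + h (T p).
  pose q : jet K r := mkjet p (fun k => if k == 1 then x1 else x2).
  have bq : base q = p by rewrite base_mkjet.
  have q1 : jx q 1 = x1 by rewrite jx_mkjet ?r0.
  have q2 : jx q 2 = x2 by rewrite jx_mkjet ?r1.
  have Oq : Om (base q) by rewrite bq.
  have := H q Oq; rewrite DqE // bq => /(_ (Tt0 _ Op)) Hq.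
  rewrite q2 in Hq; rewrite Hq.
  rewrite (@sum_leading _ _ 2 _ (fun k => prolong_coord tau k.+1 q)).
  - rewrite big_ord_recl big_ord1 y1E // bq q1.
    by have := y2E x1 x2; rewrite /= => <-.
  - apply: (incidence_elim (tau := tau) (p := p) (h := h (T p)) r3) => //; first exact: D0.
    by move=> q' bq' Dq'; have := H q'; rewrite bq' => /(_ Op Dq').
  - by lia.
have Tp := Tt0 _ Op.
have g1N0 : g1 != 0.
  apply: contraNneq c0 => g10; have := HE 0 1; have := HE 0 0.
  by rewrite g10 !mul0r mul1r => <- ->.
apply: (quadratic_vanishing Tp g1N0) => x.
by have := HE x 0; rewrite !mul0r [X in X / _]addr0; exact.
Qed.

End IncidenceConsequences.

(** * Local form of equivalence transformations *)

Lemma open_disk (K : numFieldType) (c e : K) : open [set z : K | `|z - c| < e].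
Proof.
have -> : [set z : K | `|z - c| < e] = ball c e; last exact: ball_open.
by apply/seteqP; split=> z; rewrite -ball_normE /ball_ /= distrC.
Qed.

Section Boxes.
Context {K : numFieldType}.
Local Notation e0 := (delta_mx ord0 ord0 : 'rV[K]_2).
Local Notation e1 := (delta_mx ord0 ord_max : 'rV[K]_2).

Definition pt (t x : K) : 'rV[K]_2 := \row_(i < 2) if i == ord0 then t else x.

Lemma pt0 t x : pt t x ord0 ord0 = t. Proof. by rewrite mxE. Qed.
Lemma pt1 t x : pt t x ord0 ord_max = x. Proof. by rewrite mxE. Qed.

Lemma ptE (p : 'rV[K]_2) : pt (p ord0 ord0) (p ord0 ord_max) = p.
Proof.
apply/rowP => i; rewrite mxE; case: eqP => [->//|/eqP i0].
by congr (p _ _); apply: val_inj; case: i i0 => [[|[|]]].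
Qed.

Lemma pt_shift0 h t x : h *: e0 + pt t x = pt (h + t) x.
Proof.
apply/rowP => i; rewrite !mxE eqxx /=.
by case: eqP => _; rewrite ?mulr1 // mulr0 add0r.
Qed.

Lemma pt_shift1 h t x : h *: e1 + pt t x = pt t (h + x).
Proof.
apply/rowP => i; rewrite !mxE eqxx /= -!val_eqE /=.
by case: i => [[|[|]]] //= _; rewrite ?mulr1 // mulr0 add0r.
Qed.

(** A product of disks, so that one-variable constancy applies in each direction. *)
Definition box (p : 'rV[K]_2) (e : K) : set 'rV[K]_2 :=
  [set q | `|q ord0 ord0 - p ord0 ord0| < e /\ `|q ord0 ord_max - p ord0 ord_max| < e].

Lemma nbhs_box (A : set 'rV[K]_2) p : nbhs p A -> exists2 e, 0 < e & box p e `<=` A.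
Proof.
move=> /nbhs_ballP[e /= e0 eA]; exists e => // q [q0 q1]; apply: eA; split=> // i j.
rewrite (ord1 i) -ball_normE /ball_ /= distrC.
have [->//|j0] := eqVneq j ord0.
by have -> : j = ord_max by apply: val_inj; case: j j0 => [[|[|]]].
Qed.

Lemma box_pt p e t x : box p e (pt t x) <->
  `|t - p ord0 ord0| < e /\ `|x - p ord0 ord_max| < e.
Proof. by rewrite /box /= pt0 pt1. Qed.

Lemma is_derive_pt0 (f : 'rV[K]_2 -> K) t x df : is_derive (pt t x) e0 f df ->
  is_derive t 1 (fun z => f (pt z x)) df.
Proof.
move=> [dz Dz].
have E h : f (pt (h *: 1 + t) x) - f (pt t x) = f (h *: e0 + pt t x) - f (pt t x).
  by rewrite pt_shift0 [_ *: 1]mulr1.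
split; first exact: (derivable_shift_eq (f := fun z => f (pt z x)) E dz).
by rewrite -Dz; exact: (derive_shift_eq (f := fun z => f (pt z x)) E).
Qed.

Lemma is_derive_pt1 (f : 'rV[K]_2 -> K) t x df : is_derive (pt t x) e1 f df ->
  is_derive x 1 (fun z => f (pt t z)) df.
Proof.
move=> [dz Dz].
have E h : f (pt t (h *: 1 + x)) - f (pt t x) = f (h *: e1 + pt t x) - f (pt t x).
  by rewrite pt_shift1 [_ *: 1]mulr1.
split; first exact: (derivable_shift_eq (f := fun z => f (pt t z)) E dz).
by rewrite -Dz; exact: (derive_shift_eq (f := fun z => f (pt t z)) E).
Qed.

Hypothesis KLC : locally_constant_on_balls K.

Lemma box_constant_x (f : 'rV[K]_2 -> K) p e : 0 < e ->
  (forall q, box p e q -> is_derive q e1 f 0) ->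
  forall t x, box p e (pt t x) -> f (pt t x) = f (pt t (p ord0 ord_max)).
Proof.
move=> e_gt0 df t x /box_pt[te xe].
apply: (KLC (f := fun z => f (pt t z)) e_gt0 _ xe) => z ze.
by apply: is_derive_pt1; apply: df; apply/box_pt.
Qed.

(** T depends on t only, hence so do T_t, X_t = phi(T) T_t and X_x, the product of T_t and a
    function free of x. So X(t, x) - X(t, x0) does not vary with t, and its x-derivative X_x,
    depending on t only, is a constant. *)
Lemma incidence_local_form r tau Om p : (3 <= r)%N -> open Om -> smooth_on Om tau ->
  (forall p, Om p -> jacobian_det tau p != 0) ->
  incidence (r := r) tau Om 1 -> incidence (r := r) tau Om 2 -> Om p ->
  exists (c e : K), [/\ c != 0, 0 < e & forall q, box p e q ->
    [/\ Om q, 'D_e1 (fun p => tau p ord0 ord0) q = 0,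
        'D_e0 (fun p => tau p ord0 ord0) q != 0 &
        tau q ord0 ord_max =
        tau (pt (q ord0 ord0) (p ord0 ord_max)) ord0 ord_max +
          c * (q ord0 ord_max - p ord0 ord_max)]].
Proof.
move=> r3 openOm stau D0 /(incidence_order1 r3 D0)[Tx0 [phi Xt]].
move=> /(incidence_order2 r3 openOm stau D0 Tx0) nx0 Op.
pose T p := tau p ord0 ord0; pose X p := tau p ord0 ord_max.
have [e e_gt0 eOm] := nbhs_box (open_nbhs_nbhs (conj openOm Op)).
set t0 := p ord0 ord0; set x0 := p ord0 ord_max.
have Tt0 q : Om q -> 'D_e0 T q != 0.
  by move=> Oq; have := D0 _ Oq; rewrite /jacobian_det Tx0 // mul0r subr0 mulf_eq0 negb_or => /andP[].
have dtau j q : Om q -> differentiable (fun p => tau p ord0 j) q.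
  move=> Oq; apply: smooth_on_differentiable Oq => k; exact: Cn_on_coord.
have ddtau v j q : Om q -> differentiable ('D_v (fun p => tau p ord0 j)) q.
  move=> Oq; apply: smooth_on_differentiable Oq; apply: smooth_on_derive => k.
  exact: Cn_on_coord.
have TE t x : box p e (pt t x) -> T (pt t x) = T (pt t x0).
  apply: box_constant_x => // q /eOm Oq.
  by split; [apply: diff_derivable; exact: dtau|exact: Tx0].
have p_box t x : box p e (pt t x) -> box p e (pt t x0).
  by move=> /box_pt[te _]; apply/box_pt; rewrite subrr normr0.
have dpt v j q : Om q -> is_derive q v (fun p => tau p ord0 j) ('D_v (fun p => tau p ord0 j) q).
  by move=> Oq; split=> //; apply: diff_derivable; exact: dtau.
have TtE t x : box p e (pt t x) -> 'D_e0 T (pt t x) = 'D_e0 T (pt t x0).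
  move=> bt; have bt0 := p_box _ _ bt.
  rewrite -(derive_val (is_derive := is_derive_pt0 (dpt e0 ord0 _ (eOm _ bt)))).
  rewrite -(derive_val (is_derive := is_derive_pt0 (dpt e0 ord0 _ (eOm _ bt0)))).
  apply: near_eq_derive; have /box_pt[te xe] := bt.
  have : nbhs t [set z : K | `|z - t0| < e].
    by apply: open_nbhs_nbhs; split; [exact: open_disk|exact: te].
  by apply: filterS => z ze; apply: TE; apply/box_pt.
have XtE t x : box p e (pt t x) -> 'D_e0 X (pt t x) = 'D_e0 X (pt t x0).
  move=> bt; have bt0 := p_box _ _ bt.
  rewrite (Xt _ (eOm _ bt)) (Xt _ (eOm _ bt0)).
  by congr (phi _ * _); [exact: TE|exact: TtE].
have XxE t x : box p e (pt t x) -> 'D_e1 X (pt t x) = 'D_e1 X (pt t x0).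
  move=> bt; have bt0 := p_box _ _ bt.
  have := @box_constant_x (fun q => 'D_e1 X q / 'D_e0 T q) p e e_gt0 _ t x bt.
  rewrite TtE // => H; apply: (mulIf (invr_neq0 (Tt0 _ (eOm _ bt0)))); apply: H.
  move=> q /eOm Oq; split; last exact: nx0.
  apply: diff_derivable; apply: differentiableM; first exact: ddtau.
  by apply: differentiableV; [exact: ddtau|exact: Tt0].
have X1 t x : box p e (pt t x) -> X (pt t x) - X (pt t x0) = X (pt t0 x) - X (pt t0 x0).
  move=> /box_pt[te xe].
  apply: (KLC (f := fun z => X (pt z x) - X (pt z x0)) e_gt0 _ te) => z ze.
  have bz : box p e (pt z x) by apply/box_pt.
  have d1 := is_derive_pt0 (dpt e0 ord_max _ (eOm _ bz)).
  have d2 := is_derive_pt0 (dpt e0 ord_max _ (eOm _ (p_box _ _ bz))).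
  have := is_deriveB d1 d2; rewrite -/X XtE // subrr; exact.
pose c := 'D_e1 X p.
have X2 x : `|x - x0| < e -> X (pt t0 x) = X (pt t0 x0) + c * (x - x0).
  move=> xe.
  have : X (pt t0 x) - x * c = X (pt t0 x0) - x0 * c.
    apply: (KLC (f := fun z => X (pt t0 z) - z * c) e_gt0 _ xe) => z ze.
    have bz : box p e (pt t0 z) by apply/box_pt; rewrite subrr normr0.
    have d1 := is_derive_pt1 (dpt e1 ord_max _ (eOm _ bz)).
    have d2 : is_derive z 1 (fun z : K => z * c) c.
      by apply: is_derive_eq; rewrite scaler0 add0r [_ *: _]mulr1.
    by have := is_deriveB d1 d2; rewrite -/X XxE // /t0 /x0 ptE subrr; exact.
  by move/eqP; rewrite subr_eq => /eqP ->; ring.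
exists c, e; split=> //.
  have := D0 _ Op; rewrite /jacobian_det Tx0 // mul0r subr0 mulf_eq0 negb_or.
  by case/andP.
move=> q bq; have Oq := eOm _ bq; split=> //; [exact: Tx0|exact: Tt0|].
rewrite -[q]ptE in bq *; have := X1 _ _ bq; rewrite X2; last by have [] := bq; rewrite pt1.
rewrite -/(X _) pt0 pt1 -/(X _) -/x0.
by move/eqP; rewrite subr_eq => /eqP ->; rewrite addrC addrAC subrr add0r.
Qed.

End Boxes.

(** * The transformation (t, x / t) *)

Section Prolongation.
Context {K : numFieldType} {r : nat}.
Implicit Types (q : jet K r) (tau : 'rV[K]_2 -> 'rV[K]_2).
Local Notation e0 := (delta_mx ord0 ord0 : 'rV[K]_2).
Local Notation e1 := (delta_mx ord0 ord_max : 'rV[K]_2).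
Local Notation E k := (delta_mx ord0 (jx_idx k) : jet K r).

Lemma base_prolong tau q : base (prolong tau q) = tau (base q).
Proof. by rewrite /base row_mxKl. Qed.

Lemma jt_prolong tau q : jt (prolong tau q) = tau (base q) ord0 ord0.
Proof. by rewrite jtE base_prolong. Qed.

Lemma jx_prolong tau q k : (k <= r)%N -> jx (prolong tau q) k = prolong_coord tau k q.
Proof.
case: k => [|k] kr; first by rewrite jx0E base_prolong.
rewrite /jx /prolong.
have -> : jx_idx k.+1 = rshift 2 (Ordinal kr) by apply: val_inj; rewrite /= inordK.
by rewrite row_mxEr mxE.
Qed.

Lemma arnold1_lhs_prolong tau q (a : 'rV[K]_(r.-1)) :
  arnold1_lhs (prolong tau q) a =
  prolong_coord tau r q + \sum_(k < r.-1) a ord0 k * prolong_coord tau k.+1 q.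
Proof.
rewrite /arnold1_lhs jx_prolong //; congr (_ + _); apply: eq_bigr => k _.
by rewrite jx_prolong //; have := ltn_ord k; lia.
Qed.

Lemma arnold1_lhs0 q : arnold1_lhs q 0 = jx q r.
Proof. by rewrite /arnold1_lhs big1 ?addr0 // => k _; rewrite mxE mul0r. Qed.

Lemma arnold1_lhs_delta q (i : 'I_r.-1) (c : K) :
  arnold1_lhs q (c *: delta_mx ord0 i) = jx q r + c * jx q i.+1.
Proof.
rewrite /arnold1_lhs (bigD1 i) //= big1 => [|k ki].
  by rewrite !mxE !eqxx mulr1 addr0.
by rewrite !mxE eqxx (negPf ki) mulr0 mul0r.
Qed.

(** The jet [q] is arbitrary: changing x^(r) alone puts it on either source equation, which alters
    x~^(r) by a known multiple of J / D^(r+1) and leaves every lower x~^(k) as it is. *)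
Lemma incidence_of_images tau Om j (a0 a1 : K -> 'rV[K]_(r.-1)) (b0 b1 : K -> K) :
  (3 <= r)%N -> (0 < j < r)%N ->
  (forall q, Om (base q) -> DtT tau q != 0 -> jx q r = 0 ->
    arnold1_lhs (prolong tau q) (a0 (tau (base q) ord0 ord0)) =
    b0 (tau (base q) ord0 ord0)) ->
  (forall q, Om (base q) -> DtT tau q != 0 -> jx q r + jx q j = 0 ->
    arnold1_lhs (prolong tau q) (a1 (tau (base q) ord0 ord0)) =
    b1 (tau (base q) ord0 ord0)) ->
  incidence (r := r) tau Om j.
Proof.
move=> r3 /andP[j0 jr] H0 H1.
have r1 : (1 < r)%N := ltnW r3.
(* [insub] extends the row of differences by 0 to a function on all naturals. *)
exists (fun u k => if insub k is Some i then a1 u ord0 i - a0 u ord0 i else 0).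
exists (fun u => b0 u - b1 u) => q Oq Dq u.
have rr : (0 < r <= r)%N by rewrite leqnn andbT (ltnW r1).
have r1r : (1 < r <= r)%N by rewrite leqnn andbT.
have yr (h : K) : prolong_coord tau r (h *: E r + q) = prolong_coord tau r q +
    h * (jacobian_det tau (base q) / DtT tau q ^+ r.+1).
  have := @prolong_coord_affine K r r3 tau r.-1 h q.
  have -> : (r.-1.+1 = r)%N by lia.
  by apply => //; lia.
have yk (h : K) (k : 'I_r.-1) : prolong_coord tau k.+1 (h *: E r + q) = prolong_coord tau k.+1 q.
  by apply: prolong_coord_shift => //; have := ltn_ord k; lia.
have sumE (h : K) (a : 'rV[K]_(r.-1)) :
    \sum_(k < r.-1) a ord0 k * prolong_coord tau k.+1 (h *: E r + q) =
    \sum_(k < r.-1) a ord0 k * prolong_coord tau k.+1 q.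
  by apply: eq_bigr => k _; rewrite yk.
have E0 : prolong_coord tau r q - jx q r * (jacobian_det tau (base q) / DtT tau q ^+ r.+1)
    + \sum_(k < r.-1) a0 u ord0 k * prolong_coord tau k.+1 q = b0 u.
  have := H0 (- jx q r *: E r + q).
  rewrite base_shiftS // DtT_shift // jx_shift // eqxx mulr1n subrr.
  by move=> /(_ Oq Dq erefl); rewrite arnold1_lhs_prolong yr sumE mulNr.
have E1 : prolong_coord tau r q + (- jx q r - jx q j) * (jacobian_det tau (base q) / DtT tau q ^+ r.+1)
    + \sum_(k < r.-1) a1 u ord0 k * prolong_coord tau k.+1 q = b1 u.
  have := H1 ((- jx q r - jx q j) *: E r + q).
  rewrite base_shiftS // DtT_shift // !jx_shift ?(ltnW jr) // eqxx gtn_eqF // mulr1n mulr0n.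
  have -> : jx q r + (- jx q r - jx q j) + (jx q j + 0) = 0 by ring.
  by move=> /(_ Oq Dq erefl); rewrite arnold1_lhs_prolong yr sumE.
have -> : \sum_(k < r.-1) (if insub (nat_of_ord k) is Some i then a1 u ord0 i - a0 u ord0 i else 0)
      * prolong_coord tau k.+1 q =
    \sum_(k < r.-1) a1 u ord0 k * prolong_coord tau k.+1 q -
    \sum_(k < r.-1) a0 u ord0 k * prolong_coord tau k.+1 q.
  rewrite -sumrB; apply: eq_bigr => k _; rewrite -mulrBl.
  by have -> : insub (nat_of_ord k) = Some k by exact: valK.
by rewrite -E0 -E1; ring.
Qed.

End Prolongation.

Section MultiplicationByInverse.
Context {K : numFieldType} {r : nat}.
Hypothesis r3 : (3 <= r)%N.
Local Notation e0 := (delta_mx ord0 ord0 : 'rV[K]_2).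
Local Notation e1 := (delta_mx ord0 ord_max : 'rV[K]_2).

Lemma ptD (t x : K) : pt t x = t *: e0 + x *: e1.
Proof.
apply/rowP => i; rewrite !mxE eqxx /= -!val_eqE /=.
by case: i => [[|[|]]] //= _; rewrite ?mulr1 ?mulr0 ?add0r ?addr0.
Qed.

Definition divt (p : 'rV[K]_2) : 'rV[K]_2 :=
  pt (p ord0 ord0) (p ord0 ord_max / p ord0 ord0).

Definition nonzero_t : set 'rV[K]_2 := [set p | p ord0 ord0 != 0].

Lemma Cn_on_id (V : normedModType K) (A : set V) n : open A -> Cn_on n A (fun p : V => p).
Proof.
move=> oA; case: n => [|n] /=; first by move=> p _; exact: cvg_id.
split=> [//|v]; apply: Cn_on_ext (Cn_on_cst oA n v) => // p _.
by rewrite derive_id.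
Qed.

Lemma open_neq0 : open [set t : K | t != 0].
Proof.
rewrite openE => t /= t0; apply/nbhs_ballP; exists `|t| => /=; first by rewrite normr_gt0.
move=> z; rewrite -ball_normE /ball_ /=; apply: contraTneq => ->.
by rewrite subr0 ltxx.
Qed.

Lemma open_nonzero_t : open nonzero_t.
Proof.
apply: (@open_comp _ _ (fun p : 'rV[K]_2 => p ord0 ord0) [set t : K | t != 0]).
  by move=> p _; exact: coord_continuous.
exact: open_neq0.
Qed.

Lemma divt_smooth : smooth_on nonzero_t divt.
Proof.
move=> n; have oN := open_nonzero_t.
have c j : Cn_on n nonzero_t (fun p : 'rV[K]_2 => p ord0 j).
  by have := Cn_on_coord oN j (Cn_on_id n oN).
have := Cn_onD oN (Cn_onZl oN e0 (c ord0))
  (Cn_onZl oN e1 (Cn_onM oN (c ord_max) (Cn_onV oN (f := fun p : 'rV[K]_2 => p ord0 ord0) (fun p h => h) (c ord0)))).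
apply: Cn_on_ext => // p _.
by rewrite /divt ptD.
Qed.

Lemma divt_point_transformation : point_transformation divt nonzero_t.
Proof.
split.
- exact: open_nonzero_t.
- by exists (pt 1 0); rewrite /nonzero_t /= pt0 oner_eq0.
- exact: divt_smooth.
move=> p p0; rewrite det_jacobian; last first.
  exact: smooth_on_differentiable divt_smooth p0.
rewrite /jacobian_det.
have -> : 'D_e0 (fun p => divt p ord0 ord0) p = 1.
  by apply: derive_affine => h; rewrite !pt0 !mxE !eqxx mulr1 addrC [_ *: 1]mulr1.
have -> : 'D_e1 (fun p => divt p ord0 ord0) p = 0.
  by apply: derive_eq0 => h; rewrite !pt0 !mxE mulr0 add0r.
have -> : 'D_e1 (fun p => divt p ord0 ord_max) p = (p ord0 ord0)^-1.
  apply: derive_affine => h; rewrite !pt1 !mxE !eqxx mulr1 mulr0 add0r.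
  by rewrite mulrDl addrC.
by rewrite mul1r mul0r subr0 invr_neq0.
Qed.

(** This is the coefficient of x^(j) in the Leibniz formula t y^(k+1) + (k+1) y^(k) = (t y)^(k+1),
    where y = x / t. The induction step differentiates the identity for k and adds the identity at j
    - 1, as D_t does. *)
Lemma prolong_coef_divt k j (t : K) : t != 0 ->
  let A := prolong_coef (fun t : K => t^-1) (fun=> 1) in
  t * A k.+1 j t + k.+1%:R * A k j t = (k.+1 == j)%:R.
Proof.
move=> t0 A.
have oN := open_neq0.
have A00 : A 0 0 = fun t : K => t^-1 by [].
have AS0 k' u : A k'.+1 0 u = 'D_1 (A k' 0) u by rewrite /A /= mul1r addr0.
have ASS k' j' u : A k'.+1 j'.+1 u = 'D_1 (A k' j'.+1) u + A k' j' u.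
  by rewrite /A /= mul1r.
have dA k' j' u : u != 0 -> derivable (A k' j') u 1.
  move=> u0; apply: diff_derivable; apply: smooth_on_differentiable u0.
  apply: (prolong_coef_smooth oN) => n; last exact: Cn_on_cst.
  by apply: Cn_onV => //; exact: Cn_on_id.
elim: k j t t0 => [|k IH] j t t0.
  case: j => [|j].
    rewrite AS0 A00 (@deriveV _ _ (fun u : K => u) t 1 t0) // derive_id [_ *: _]mulr1 mul1r.
    by rewrite expr2 invfM mulrN mulrA divff // mul1r addNr.
  rewrite ASS [A 0 j.+1](_ : _ = cst 0) // derive_cst add0r mulr0 addr0 eqSS.
  by case: j => [|j]; rewrite ?A00 ?divff // [A 0 _ _](_ : _ = 0) // mulr0.
have DIH j' : A k.+1 j' t + t * 'D_1 (A k.+1 j') t + k.+1%:R * 'D_1 (A k j') t = 0.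
  have D0 : 'D_1 (fun u : K => u * A k.+1 j' u + k.+1%:R * A k j' u) t = 0.
    transitivity ('D_1 (fun _ : K => (k.+1 == j')%:R : K) t); last exact: derive_cst.
    by apply: near_eq_derive; exact: (open_near_eq oN (IH j')).
  have dt : derivable (fun u : K => u) t 1 by exact: derivable_id.
  have d1 := derivableM dt (dA k.+1 j' _ t0).
  have d2 := derivableM (derivable_cst (k.+1%:R : K) t 1) (dA k j' _ t0).
  move: D0; rewrite [LHS](deriveD d1 d2) [X in X + _](deriveM dt (dA k.+1 j' _ t0)).
  rewrite [X in _ + X](deriveMl _ (dA k j' _ t0)) derive_id => D0.
  by rewrite -[RHS]D0 [_ *: 1]mulr1 [X in X + _ = _]addrC.
rewrite -[k.+2%:R]natr1; case: j => [|j].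
  by rewrite AS0 -[RHS](DIH 0) -(AS0 k); ring.
have := DIH j.+1; rewrite !ASS eqSS -(IH j t t0) => D.
by apply/eqP; rewrite -subr_eq0 -[X in _ == X]D; apply/eqP; ring.
Qed.

(** Leibniz formula for x = t y on jets. At k = r - 1 it turns x^(r) = 0 into t y^(r) + r y^(r-1) =
    0. *)
Lemma prolong_divt (q : jet K r) k : (k < r)%N -> nonzero_t (base q) ->
  jt q * prolong_coord divt k.+1 q + k.+1%:R * prolong_coord divt k q = jx q k.+1.
Proof.
move=> kr bq.
have oN := open_neq0.
have jq0 : jt q != 0 by rewrite jtE.
have s'1 : (fun t : K => ('D_1 (fun t : K => t) t)^-1) = fun=> 1.
  by apply/funext => t; rewrite derive_id invr1.
have g0 j t : prolong_rest (fun=> 0) (fun=> 1) j t = 0 :> K.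
  elim: j t => // j IH t /=.
  by rewrite (_ : prolong_rest _ _ j = cst 0) ?derive_cst ?mulr0 //; exact/funext.
have yE j : (j <= r)%N -> prolong_coord divt j q =
    \sum_(i < r.+1) prolong_coef (fun t : K => t^-1) (fun=> 1) j i (jt q) * jx q i.
  move=> jr; rewrite (@prolong_coord_fibre_linear _ _ divt nonzero_t [set t | t != 0]
    (fun t => t) (fun t => t^-1) (fun=> 0)) //.
  - by rewrite s'1 g0 addr0.
  - exact: ltnW r3.
  - exact: open_nonzero_t.
  - by move=> n; exact: Cn_on_id.
  - by move=> n; apply: Cn_onV => //; exact: Cn_on_id.
  - by move=> n; exact: Cn_on_cst.
  - by move=> t _; rewrite derive_id oner_neq0.
  - by move=> p _; rewrite pt0.
  - by move=> p _; rewrite pt1 addr0 mulrC.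
rewrite !yE ?(ltnW kr) // !mulr_sumr -big_split.
rewrite (eq_bigr (fun i : 'I_r.+1 => (k.+1 == i)%:R * jx q i)) => [|i _]; last first.
  by rewrite -(prolong_coef_divt k i jq0) mulrDl !mulrA.
rewrite (bigD1 (inord k.+1)) // big1 ?addr0 => [|i ik].
  by rewrite inordK // eqxx mul1r; exact: addr0.
rewrite [_ == _](_ : _ = false) ?mul0r //.
by apply: contraNF ik => /eqP ik; apply/eqP/val_inj; rewrite /= inordK.
Qed.

End MultiplicationByInverse.

(** * Non-existence of the factorization *)

Lemma Cn_on_subset (K : numFieldType) (V W : normedModType K) (A B : set V) n (f : V -> W) :
  B `<=` A -> Cn_on n A f -> Cn_on n B f.
Proof.
move=> BA; elim: n f => [|n IH] f /=; first by move=> fc p /BA; exact: fc.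
by move=> [df Df]; split=> [p /BA|v]; [exact: df|exact: IH].
Qed.

Lemma open_box (K : numFieldType) (p : 'rV[K]_2) (e : K) : open (box p e).
Proof.
have c j : open [set q : 'rV[K]_2 | `|q ord0 j - p ord0 j| < e].
  apply: (@open_comp _ _ (fun q : 'rV[K]_2 => q ord0 j) [set t : K | `|t - p ord0 j| < e]).
    by move=> q _; exact: coord_continuous.
  exact: open_disk.
exact: (openI (c ord0) (c ord_max)).
Qed.

Section Factorization.
Context {K : numFieldType} {r : nat}.
Hypotheses (KLC : locally_constant_on_balls K) (r3 : (3 <= r)%N).
Variables (S sigma : 'rV[K]_2 -> 'rV[K]_2) (U Om : set 'rV[K]_2).
Hypotheses (ptS : point_transformation S U)
  (symS : forall q : jet K r, U (base q) -> DtT S q != 0 -> jx q r = 0 ->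
     prolong_coord S r q = 0)
  (pts : point_transformation sigma Om)
  (inc1 : incidence (r := r) sigma Om 1) (inc2 : incidence (r := r) sigma Om 2)
  (U0 : forall p, U p -> p ord0 ord0 != 0)
  (US : forall p, U p -> Om (S p)) (divE : forall p, U p -> divt p = sigma (S p)).
Local Notation e0 := (delta_mx ord0 ord0 : 'rV[K]_2).
Local Notation e1 := (delta_mx ord0 ord_max : 'rV[K]_2).
Local Notation E k := (delta_mx ord0 (jx_idx k) : jet K r).

Let r1 : (1 < r)%N := ltnW r3.

Lemma row2E (v : 'rV[K]_2) : v = v ord0 ord0 *: e0 + v ord0 ord_max *: e1.
Proof. by rewrite -ptD ptE. Qed.

(** Compare sigma o S with (t, x / t). As T_x = 0, differentiating the first component in x gives
    T_t times the x-derivative of the first component of S, which is therefore 0. As X is affine in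
    x with slope c, the second component shows that c times the increment of the second component of
    S is (x - x0) / t. *)
Lemma fibre_linear_factor u : U u -> exists (c : K) (e : K), [/\ c != 0, 0 < e,
  box u e `<=` U & forall q, box u e q ->
    [/\ 'D_e1 (fun p => S p ord0 ord0) q = 0,
        S q ord0 ord0 = S (pt (q ord0 ord0) (u ord0 ord_max)) ord0 ord0 &
        S q ord0 ord_max = S (pt (q ord0 ord0) (u ord0 ord_max)) ord0 ord_max +
          c^-1 * (q ord0 ord0)^-1 * (q ord0 ord_max - u ord0 ord_max)]].
Proof.
move=> Uu; have [oU _ sS dS] := ptS; have [oOm _ ss ds] := pts.
have D0 p : Om p -> jacobian_det sigma p != 0.
  move=> Op; rewrite -det_jacobian; first exact: ds.
  exact: smooth_on_differentiable ss Op.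
have [c [e [c0 e_gt0 H]]] := incidence_local_form KLC r3 oOm ss D0 inc1 inc2 (US Uu).
have dSU p : U p -> differentiable S p by move=> Up; exact: smooth_on_differentiable sS Up.
have bSu : nbhs (S u) (box (S u) e).
  apply: open_nbhs_nbhs; split; first exact: open_box.
  by split; rewrite subrr normr0.
have : nbhs u (U `&` S @^-1` (box (S u) e)).
  apply: filterI; first exact: open_nbhs_nbhs.
  exact: (differentiable_continuous (dSU _ Uu)).
move=> /nbhs_box[d d0 dB]; exists c, d.
have Sx0 q : box u d q -> 'D_e1 (fun p => S p ord0 ord0) q = 0.
  move=> /dB[Uq bq]; have [Oq Tx0 Tt0 _] := H _ bq.
  have dT : differentiable (fun p => sigma p ord0 ord0) (S q).
    by apply: differentiable_coordE; exact: smooth_on_differentiable ss Oq.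
  have : 'D_e1 ((fun p => sigma p ord0 ord0) \o S) q = 0.
    rewrite (near_eq_derive (g := fun p : 'rV[K]_2 => p ord0 ord0 : K)).
      by apply: derive_eq0 => h; rewrite !mxE mulr0 add0r.
    apply: filterS (open_nbhs_nbhs (conj oU Uq)) => z Uz.
    by rewrite /= -divE // pt0.
  rewrite deriveE; last exact: differentiable_comp (dSU _ Uq) dT.
  rewrite diff_comp //; last exact: dSU.
  rewrite /= -(deriveE _ (dSU _ Uq)) (row2E ('D_e1 S q)) linearD !linearZ /=.
  rewrite -!(deriveE _ dT) Tx0 scaler0 addr0 -derive_coord; last exact: dSU.
  by move=> /eqP; rewrite mulf_eq0 (negPf Tt0) orbF => /eqP.
have S0E t x : box u d (pt t x) -> S (pt t x) ord0 ord0 = S (pt t (u ord0 ord_max)) ord0 ord0.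
  apply: (box_constant_x KLC (f := fun p => S p ord0 ord0)) => // q bq.
  split; last exact: Sx0.
  by apply: diff_derivable; apply: differentiable_coordE; apply: dSU; have [] := dB _ bq.
split=> // [q /dB[]//|q bq]; split; first exact: Sx0.
  by rewrite -[in LHS](ptE q) S0E ?ptE.
(* [q0] has the same t as [q] and lies on the central line. The first components of S agree there,
   so the unknown function of t in the local form cancels in the difference. *)
set q0 := pt (q ord0 ord0) (u ord0 ord_max).
have bq0 : box u d q0 by case: bq => q00 _; apply/box_pt; rewrite subrr normr0.
have [[Uq bSq] [Uq0 bSq0]] := (dB _ bq, dB _ bq0).
have q0E : S q ord0 ord0 = S q0 ord0 ord0 by rewrite -[in LHS](ptE q) S0E ?ptE.
have [_ _ _ E1] := H _ bSq; have [_ _ _ E0] := H _ bSq0.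
rewrite -!divE // q0E !pt1 pt0 in E1 E0.
have cq : c * (S q ord0 ord_max - S q0 ord0 ord_max) = (q ord0 ord_max - u ord0 ord_max) / q ord0 ord0.
  rewrite mulrBl E1 E0; ring.
apply/eqP; rewrite addrC -subr_eq; apply/eqP; apply: (mulfI c0).
by rewrite cq -mulrA mulVKf // mulrC.
Qed.

Lemma no_factorization : False.
Proof.
have [oU [u Uu] sS dS] := ptS.
have [c [e [c0 e_gt0 bU HS]]] := fibre_linear_factor Uu.
pose t0 := u ord0 ord0; pose x0 := u ord0 ord_max.
pose I := [set t : K | `|t - t0| < e].
have oI : open I by exact: open_disk.
have IB t x : I t -> `|x - x0| < e -> box u e (pt t x) by move=> It xe; apply/box_pt.
have bx0 : `|x0 - x0| < e by rewrite subrr normr0.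
have I0 t : I t -> t != 0.
  by move=> It; have := U0 (bU _ (IB _ _ It bx0)); rewrite pt0.
have sline : smooth_on I (fun t : K => S (pt t x0)).
  move=> n; have := Cn_on_line e0 (pt 0 x0) (sS n).
  have -> : (fun t : K => S (t *: e0 + pt 0 x0)) = fun t : K => S (pt t x0).
    by apply/funext => t; rewrite pt_shift0 addr0.
  apply: (Cn_on_subset (B := I)) => t It /=; rewrite pt_shift0 addr0.
  exact/bU/IB.
pose s (t : K) := S (pt t x0) ord0 ord0.
pose m (t : K) := c^-1 * t^-1.
(* The factor S is known relative to the line x = x0; subtracting [x0 * m t] recentres it at x =
   0. *)
pose g (t : K) := S (pt t x0) ord0 ord_max - x0 * m t.
have ss : smooth_on I s by move=> n; exact: Cn_on_coord.
have sm : smooth_on I m.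
  move=> n; apply: Cn_onM => //; first exact: Cn_on_cst.
  by apply: Cn_onV => //; exact: Cn_on_id.
have sg : smooth_on I g.
  move=> n; apply: Cn_onD => //; first exact: Cn_on_coord.
  have := Cn_onM oI (Cn_on_cst oI n (- x0)) (sm n).
  by under eq_fun do rewrite mulNr.
have s'0 t : I t -> 'D_1 s t != 0.
  move=> It; have bt := IB _ _ It bx0; have Ut := bU _ bt.
  have dSt := smooth_on_differentiable sS Ut.
  have := dS _ Ut; rewrite det_jacobian // /jacobian_det.
  have [-> _ _] := HS _ bt; rewrite mul0r subr0 mulf_eq0 negb_or => /andP[+ _].
  have ds : is_derive (pt t x0) e0 (fun p => S p ord0 ord0) ('D_e0 (fun p => S p ord0 ord0) (pt t x0)).
    by split=> //; apply: diff_derivable; exact: differentiable_coordE.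
  by rewrite -(derive_val (is_derive := is_derive_pt0 ds)).
have oB : open (box u e) by exact: open_box.
have S0 p : box u e p -> S p ord0 ord0 = s (p ord0 ord0) by case/HS.
have S1 p : box u e p -> S p ord0 ord_max = m (p ord0 ord0) * p ord0 ord_max + g (p ord0 ord0).
  by case/HS => _ _ ->; rewrite /g /m -/x0; ring.
have BI p : box u e p -> I (p ord0 ord0) by case.
pose w t := ('D_1 s t)^-1.
have A0 j t : (0 < j < r)%N -> I t -> prolong_coef m w r j t = 0.
  move=> /andP[j0 jr] It; have bt := IB _ _ It bx0.
  (* Over (t, x0), take all derivatives zero except x^(j) = h. As j < r, these jets satisfy x^(r) =
     0, and so do their images; the images for h = 1 and h = 0 differ in x~^(r) by A_(r,j). *)
  pose q0 : jet K r := mkjet (pt t x0) (fun=> 0).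
  have bq0 : base q0 = pt t x0 by rewrite base_mkjet.
  have yr (h : K) : \sum_(i < r.+1) prolong_coef m w r i t * jx (h *: E j + q0) i +
      prolong_rest g w r t = 0.
    have bq : base (h *: E j + q0) = pt t x0 by rewrite base_shiftS ?j0 ?(ltnW jr).
    have jtq : jt (h *: E j + q0) = t by rewrite jtE bq pt0.
    have Bq : box u e (base (h *: E j + q0)) by rewrite bq.
    have := prolong_coord_fibre_linear r1 oB oI BI ss sm sg s'0 S0 S1 (leqnn r) Bq.
    rewrite jtq => <-; apply: symS.
    - exact: bU.
    - by rewrite (DtT_fibre_preserving r1 oB S0 Bq) jtq s'0.
    - rewrite jx_shift ?(ltnW jr) // (ltn_eqF jr) addr0 jx_mkjet //.
      by rewrite leqnn andbT (ltnW r1).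
  have jr' : (j < r.+1)%N := ltnW jr.
  have := etrans (yr 1) (esym (yr 0)); rewrite scale0r add0r => /addIr/eqP.
  rewrite -subr_eq0 -sumrB (bigD1 (Ordinal jr')) //= big1 => [|i ij].
    rewrite jx_shift ?(ltnW jr) // eqxx mulr1n mulrDr mulr1 addr0 addrAC subrr add0r.
    by move/eqP.
  rewrite jx_shift ?(ltnW jr) ?leq_ord // [_ == _](_ : _ = false) ?addr0 ?subrr //.
  by apply: contraNF ij => /eqP ij; apply/eqP/val_inj.
have sw : smooth_on I w.
  by move=> n; apply: Cn_onV => //; exact: smooth_on_derive.
have w0 t : I t -> w t != 0 by move=> It; rewrite invr_neq0 ?s'0.
apply: (@no_symmetry K I c^-1 w r oI I0 (invr_neq0 c0) sw w0 r3 A0 t0).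
by rewrite /I /= subrr normr0.
Qed.

End Factorization.

(* F stands for the left-hand side of either class; inj embeds the coefficients
   (a_1, ..., a_(r-1)) into its arbitrary elements. *)
Section NotSemiNormalized.
Context {K : numFieldType} {r : nat}.
Hypotheses (KLC : locally_constant_on_balls K) (r3 : (3 <= r)%N).
Variables (n : nat) (F : jet K r -> 'rV[K]_n -> K).
Variables (pa : 'rV[K]_n -> 'rV[K]_(r.-1)) (pb : 'rV[K]_n -> K)
  (inj : 'rV[K]_(r.-1) -> 'rV[K]_n).
Hypotheses (FE : forall q th, F q th = arnold1_lhs q (pa th) - pb th)
  (Finj : forall q a, F q (inj a) = arnold1_lhs q a)
  (injZ : forall (c : K) a, inj (c *: a) = c *: inj a).
Let C := OdeClass F.

Definition const_ode (th : 'rV[K]_n) : ode C :=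
  @Ode K C setT (fun=> th) openT (ex_intro _ 0 I)
    (fun k => Cn_on_cst openT k th).

Lemma subdiag_ode_smooth (th : 'rV[K]_n) :
  smooth_on [set t : K | t != 0] (fun t : K => t^-1 *: th).
Proof.
have oN := @open_neq0 K.
by move=> k; apply: Cn_onZl => //; apply: Cn_onV => //; exact: Cn_on_id.
Qed.

(* For th = r times the unit vector of a_(r-1): x^(r) + (r / t) x^(r-1) = 0. *)
Definition inverse_ode (th : 'rV[K]_n) : ode C :=
  @Ode K C [set t : K | t != 0] (fun t => t^-1 *: th) open_neq0
    (ex_intro _ 1 (oner_neq0 K)) (subdiag_ode_smooth th).

Lemma manifold_const_ode a q :
  manifold (const_ode (inj a)) q <-> arnold1_lhs q a = 0.
Proof. by rewrite /manifold /= Finj; split=> [[]|]. Qed.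

Lemma divt_admissible :
  exists th, admissible (const_ode (inj 0)) (inverse_ode th) divt nonzero_t.
Proof.
(* The entry r - 2 of the row of coefficients is a_(r-1). *)
have i0 : (r.-2 < r.-1)%N by lia.
exists (inj (r%:R *: delta_mx ord0 (Ordinal i0))).
split=> //; first exact: divt_point_transformation.
move=> q q0 _ _ /=; have t0 : jt q != 0 by rewrite jtE.
have jp : jt (prolong divt q) = jt q by rewrite jt_prolong pt0 jtE.
split; first by rewrite /= jp.
rewrite manifold_const_ode arnold1_lhs0 /manifold /= jp -injZ scalerA Finj arnold1_lhs_delta.
have r1E : (Ordinal i0).+1 = r.-1 by rewrite /=; lia.
have rE : r = r.-1.+1 by lia.
rewrite r1E !jx_prolong ?leq_pred //.
have := @prolong_divt K r r3 q r.-1; rewrite -rE => /(_ (leqnn r) q0) yE.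
have {}yE : prolong_coord divt r q + (jt q)^-1 * r%:R * prolong_coord divt r.-1 q = (jt q)^-1 * jx q r.
  by rewrite -yE mulrDr mulKf // mulrA.
rewrite yE; split=> [-> | [_ /eqP]]; first by rewrite mulr0.
by rewrite mulf_eq0 invr_eq0 (negPf t0) => /eqP.
Qed.

Lemma linear_class_not_semi_normalized : ~ semi_normalized C.
Proof.
move=> H; have [th adm] := divt_admissible.
have [U [S [Phi [Wd [sigma [OmPhi [UOm symS [_ [pts _] _ eqv] fac]]]]]]] := H _ _ _ _ adm.
have [ptS _ mapS] := symS.
have inc j : (0 < j < r)%N -> incidence (r := r) sigma OmPhi j.
  move=> /andP[j0 jr]; have i0 : (j.-1 < r.-1)%N by lia.
  (* The sources are x^(r) = 0 and x^(r) + x^(j) = 0, with a_j at the entry j - 1. Their images may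
     be inhomogeneous, whence the terms [pb]. *)
  have [E0 [map0 _]] := eqv (const_ode (inj 0)).
  have [E1 [map1 _]] := eqv (const_ode (inj (1 *: delta_mx ord0 (Ordinal i0)))).
  apply: (@incidence_of_images K r sigma OmPhi j (pa \o par E0) (pa \o par E1) (pb \o par E0) (pb \o par E1) r3).
  - by rewrite j0.
  - move=> q Oq Dq xr; have [_ [+ _]] := map0 q Oq I Dq.
    rewrite manifold_const_ode arnold1_lhs0 => /(_ xr)[_ /=].
    by rewrite FE jt_prolong => /eqP; rewrite subr_eq0 => /eqP.
  - move=> q Oq Dq xr; have [_ [+ _]] := map1 q Oq I Dq.
    rewrite manifold_const_ode arnold1_lhs_delta /= prednK // mul1r => /(_ xr)[_ /=].
    by rewrite FE jt_prolong => /eqP; rewrite subr_eq0 => /eqP.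
apply: (@no_factorization K r KLC r3 S sigma U OmPhi) => //.
- move=> q Uq Dq xr; have [_ [+ _]] := mapS q Uq I Dq.
  by rewrite !manifold_const_ode !arnold1_lhs0 jx_prolong //; exact.
- by apply: inc; lia.
- by apply: inc; lia.
- by move=> p /fac[].
- by move=> p /fac[].
Qed.

End NotSemiNormalized.

Lemma A1_hom_not_semi_normalized (K : numFieldType) (r : nat) :
  locally_constant_on_balls K -> (3 <= r)%N -> ~ semi_normalized (A1_hom K r).
Proof.
move=> KLC r3.
apply: (@linear_class_not_semi_normalized K r KLC r3 _ _ id (fun=> 0) id) => //.
by move=> q th; rewrite subr0.
Qed.

Lemma A1_not_semi_normalized (K : numFieldType) (r : nat) :
  locally_constant_on_balls K -> (3 <= r)%N -> ~ semi_normalized (A1 K r).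
Proof.
move=> KLC r3.
apply: (@linear_class_not_semi_normalized K r KLC r3 _ _ lsubmx
  (fun th => rsubmx th ord0 ord0) (fun a => row_mx a 0)) => //.
- by move=> q a; rewrite row_mxKl row_mxKr mxE subr0.
- by move=> c a; rewrite scale_row_mx scaler0.
Qed.

Theorem corollary19 (R : realType) (r : nat) (hr : (3 <= r)%N) :
  (~ semi_normalized (A1 R r) /\ ~ semi_normalized (A1_hom R r)) /\
  (~ semi_normalized (A1 R[i] r) /\ ~ semi_normalized (A1_hom R[i] r)).
Proof.
have [real complex] := (@real_locally_constant R, @complex_locally_constant R).
split; split.
- exact: A1_not_semi_normalized.
- exact: A1_hom_not_semi_normalized.
- exact: A1_not_semi_normalized.
- exact: A1_hom_not_semi_normalized.
Qed.
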